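(* Suppose Assumptions (A1) and (A2) below hold and $q_\tau$ satisfies the model assumptions below. Run the online P-FGD algorithm below (one new observation per step) with step size $\gamma_t = A/t$ and truncation dimension $J_t = \lceil t^{1/(2s+1)}\rceil$. Then for a sufficiently large constant $A>0$ (depending only on the constants in the assumptions), the estimator $\widehat q_t$ satisfies $$\mathbb{E}\,\|\widehat q_t - q_\tau\|_{L_2}^2 = \mathbb{E}\int_{[0,1]^p} (\widehat q_t(\mathbf{x}) - q_\tau(\mathbf{x}))^2\,d\mathbf{x} = O\big(t^{-\frac{2s}{2s+1}}\big)\quad\text{as } t\to\infty.$$
   Context: Data: $(\mathbf{X}_t, Y_t)$, $t=1,2,\dots$, are i.i.d. copies of a random pair $(\mathbf{X},Y)\in[0,1]^p\times\mathbb{R}$, arriving one at a time. Fix $\tau\in(0,1)$ and let $q_\tau(\mathbf{x}) = \inf\{v\in\mathbb{R}: F_{Y|\mathbf{X}=\mathbf{x}}(v)\ge\tau\}$ be the conditional $\tau$-quantile. Pinball loss: $\rho_\tau(u) = u(\tau - \mathbb{I}(u\le 0))$. Bases: for each $k=1,\dots,p$, $\{\psi_{kj}\}_{j\ge1}$ is an orthonormal basis (w.r.t. Lebesgue measure) of functions in $L_2[0,1]$ that is centered ($\int_0^1\psi_{kj}=0$), with $\sup_{k,j}\|\psi_{kj}\|_\infty\le M$ for some $M\ge 1$. Write $\mathbf{x} = (x^{(1)},\dots,x^{(p)})$. Model: $q_\tau(\mathbf{x}) = \alpha^* + \sum_{k=1}^p f_k(x^{(k)})$ with $f_k = \sum_{j\ge1}\theta^*_{kj}\psi_{kj}$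 and $\sum_{j\ge1} j^{2s}(\theta^*_{kj})^2 < Q^2$ for each $k$, where $s>1/2$ and $Q>0$ are known constants. Let $R>0$ be a constant with $\|\boldsymbol\theta^*\|_1 := |\alpha^*| + \sum_{k,j}|\theta^*_{kj}| \le R$, and set $B := MR$ (so $\|q_\tau\|_\infty\le B$). Assumption (A1): $\mathbf{X}$ has a density $p_X$ with $0<C_1\le p_X(\mathbf{x})\le C_2<\infty$ for all $\mathbf{x}\in[0,1]^p$. Assumption (A2): for each $\mathbf{x}$, $Y$ given $\mathbf{X}=\mathbf{x}$ has a density $p_{Y|\mathbf{X}}(y|\mathbf{x})$ with $c_1\le p_{Y|\mathbf{X}}(y|\mathbf{x})\le c_2$ for all $\mathbf{x}\in[0,1]^p$ and all $y\in[-B,B]$, for constants $c_1,c_2>0$. Algorithm (P-FGD): given a nondecreasing sequence of integers $J_t$ and step sizes $\gamma_t>0$, define $\boldsymbol\Psi_t(\mathbf{x}) = (1,\psi_{11}(x^{(1)}),\dots,\psi_{1J_t}(x^{(1)}),\dots,\psi_{p1}(x^{(p)}),\dots,\psi_{pJ_t}(x^{(p)}))^\top\in\mathbb{R}^{1+pJ_t}$. Set $\boldsymbol\theta_0=\mathbf{0}$. At step $t$: pad $\boldsymbol\theta_{t-1}$ with zeros (in the coordinates of the newly added basis functions) to dimension $1+pJ_t$; compute $g_t = (\tau - \mathbb{I}(Y_t\le \boldsymbol\theta_{t-1}^\top\boldsymbol\Psi_t(\mathbf{X}_t)))\boldsymbol\Psi_t(\mathbf{X}_t)$; set $\tilde{\boldsymbol\theta}_t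 = \boldsymbol\theta_{t-1}+\gamma_t g_t$ and $\boldsymbol\theta_t = \Pi_{\mathcal{B}(R)}(\tilde{\boldsymbol\theta}_t)$, where $\Pi_{\mathcal{B}(R)}(\mathbf{u}) = \arg\min_{\|\mathbf{v}\|_1\le R}\|\mathbf{u}-\mathbf{v}\|_2$ is the Euclidean projection onto the $\ell_1$-ball of radius $R$. The estimator is $\widehat q_t(\mathbf{x}) = \boldsymbol\theta_t^\top\boldsymbol\Psi_t(\mathbf{x})$. $\|\cdot\|_{L_2}$ denotes the $L_2$ norm with respect to Lebesgue measure on $[0,1]^p$. *)

(* Defs.v *)
From Stdlib Require Import ClassicalEpsilon.
From mathcomp Require Import all_boot all_order all_algebra.
From mathcomp Require Import all_classical all_reals all_analysis.

Set Implicit Arguments.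
Unset Strict Implicit.
Unset Printing Implicit Defensive.

Import Order.TTheory GRing.Theory Num.Theory.
Local Open Scope classical_set_scope.
Local Open Scope ring_scope.

Section PFGD.
Variable R : realType.
Variable p : nat.

Definition in_cube n (x : n.-tuple R) : Prop := forall k, 0 <= tnth x k <= 1.

(* Lebesgue integral over [0,1]^n of a nonnegative function, written as an
   iterated integral w.r.t. one-dimensional Lebesgue measure (Tonelli). *)
Fixpoint cube_int (n : nat) : (n.-tuple R -> \bar R) -> \bar R :=
  match n return (n.-tuple R -> \bar R) -> \bar R with
  | 0 => fun f => f [tuple]
  | n'.+1 => fun f =>
      (\int[@lebesgue_measure R]_(u in `[0%R, 1%R]) cube_int (fun v => f [tuple of u :: v]))%E
  end.

Definition cond_cdf (pYX : p.-tuple R -> R -> R) (x : p.-tuple R) (v : R) : \bar R :=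
  (\int[@lebesgue_measure R]_(y in `]-oo, v]) (pYX x y)%:E)%E.

Definition cond_quantile (tau : R) (pYX : p.-tuple R -> R -> R) (x : p.-tuple R) : R :=
  inf [set v | (tau%:E <= cond_cdf pYX x v)%E].

(* A parameter vector (alpha, (theta_{kj})): the intercept, and the
   coefficient of psi_{k,j+1} stored at (k, j) (0-based j). Vectors of
   dimension 1 + p J are those supported in j < J; zero padding is implicit. *)
Definition param := (R * ('I_p -> nat -> R))%type.

Definition supported (J : nat) (u : param) : Prop :=
  forall k j, (J <= j)%N -> u.2 k j = 0.

Definition l1n (J : nat) (u : param) : R :=
  `|u.1| + \sum_(k < p) \sum_(j < J) `|u.2 k j|.

Definition dist2 (J : nat) (u v : param) : R :=
  (u.1 - v.1) ^+ 2 + \sum_(k < p) \sum_(j < J) (u.2 k j - v.2 k j) ^+ 2.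

Definition is_l1proj (J : nat) (Rad : R) (u v : param) : Prop :=
  [/\ supported J v, l1n J v <= Rad &
      forall w, supported J w -> l1n J w <= Rad -> dist2 J u v <= dist2 J u w].

Definition param0 : param := (0, fun _ _ => 0).

Definition l1proj (J : nat) (Rad : R) (u : param) : param :=
  epsilon (inhabits param0) (is_l1proj J Rad u).

Definition evalp (psi : 'I_p -> nat -> R -> R) (J : nat) (u : param)
    (x : p.-tuple R) : R :=
  u.1 + \sum_(k < p) \sum_(j < J) u.2 k j * psi k j (tnth x k).

Definition Jt (s : R) (t : nat) : nat := `|Num.ceil (t%:R `^ (1 / (2 * s + 1)))|%N.

Definition pfgd_step (tau s A Rad : R) (psi : 'I_p -> nat -> R -> R) (t : nat)
    (u : param) (x : p.-tuple R) (y : R) : param :=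
  let J := Jt s t in
  let gam := A / t%:R in
  let g := tau - ((y <= evalp psi J u x)%R)%:R in
  l1proj J Rad (u.1 + gam * g,
                fun k j => if (j < J)%N then u.2 k j + gam * g * psi k j (tnth x k)
                           else 0).

Fixpoint pfgd_theta (tau s A Rad : R) (psi : 'I_p -> nat -> R -> R)
    (X : nat -> p.-tuple R) (Y : nat -> R) (t : nat) : param :=
  match t with
  | 0 => param0
  | t'.+1 => pfgd_step tau s A Rad psi t'.+1
               (pfgd_theta tau s A Rad psi X Y t') (X t'.+1) (Y t'.+1)
  end.

Definition pfgd_qhat (tau s A Rad : R) (psi : 'I_p -> nat -> R -> R)
    (X : nat -> p.-tuple R) (Y : nat -> R) (t : nat) (x : p.-tuple R) : R :=
  evalp psi (Jt s t) (pfgd_theta tau s A Rad psi X Y t) x.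

End PFGD.

(* Main.v *)
(** Let G(u) be the integrated squared error of the parameter u.  By Parseval, if u is
    supported in the first J coordinates then G(u) = |u - theta*|^2 + tail(J), where
    tail(J) <= p Q^2 J^(-2s) is the squared norm of the part of theta* beyond J.  The
    projection onto the l1-ball is nonexpansive towards the truncation of theta*, so one
    step with gradient g and step size gamma gives
      G(new) <= G(old) + 2 gamma <g, old - theta*> + gamma^2 |g|^2.
    Averaging over Y given X = x replaces the indicator in g by F(qhat(x)), where F is the
    conditional cdf; the density bounds give (tau - F(v)) (v - q) <= - c1 (v - q)^2 and
    |tau - F(v)| <= c2 |v - q|, and Young's inequality absorbs the truncation error.  Hence
      E G_t <= (1 - A c1 C1 / t) E G_(t-1) + K t^(-1 - 2s/(2s+1)),
    which forces E G_t = O(t^(-2s/(2s+1))) as soon as A c1 C1 >= 2. *)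
Require Import Defs.
From Stdlib Require Import ClassicalEpsilon.
From HB Require Import structures.
From mathcomp Require Import all_boot all_order all_algebra.
From mathcomp Require Import all_classical all_reals all_analysis.
From mathcomp Require Import measurable_realfun ring lra.
Import Order.TTheory GRing.Theory Num.Theory.
Import numFieldTopology.Exports.
Local Open Scope classical_set_scope.
Local Open Scope ring_scope.

Set Implicit Arguments.
Unset Strict Implicit.
Unset Printing Implicit Defensive.

(** * Projection onto the l1-ball *)

(** Two objects are not given by formulas: the projection is picked by [epsilon], and q is an
    infimum. Expectations need both to be measurable, so the projection is identified with
    soft-thresholding at an explicit level, and q with the pointwise limit of its partial sums. The
    l1-ball does double duty: it contains the truncations of theta*, and it keeps qhat in [-B, B],
    the only range where the conditional density is controlled.

    Exponents: g has 1 + pJ coordinates of size at most M, so gamma^2 |g|^2 is of order t^(-2) J,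
    while truncation contributes gamma J^(-2s); J = t^(1/(2s+1)) makes the two orders equal. The
    constant 2: with b = 2s/(2s+1) <= 1, passing from t^(-b) to (t+1)^(-b) costs a factor at most 1
    + 1/t, and the forcing term costs at most another C/t; a contraction rate a >= 2 pays for
    both. *)

Section l1_projection.
Variable R : realType.
Implicit Types (l x y : R).

(** Projection of x onto [-l, l]. The residual x - clip l x is the soft-thresholding of x at level
    l, and [shrink l x] is its absolute value. *)
Definition clip l x : R := Num.max (- l) (Num.min l x).

Definition shrink l x : R := Num.max (`|x| - l) 0.

Lemma norm_clip l x : 0 <= l -> `|clip l x| <= l.
Proof.
by move=> l0; rewrite /clip; case: (ltP l x) => ? ; case: (ltP (- l) _) => ?;
  rewrite ler_norml; lra.
Qed.

Lemma norm_sub_clip l x : 0 <= l -> `|x - clip l x| = shrink l x.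
Proof.
move=> l0; rewrite /clip /shrink; case: (ltP l x) => ? ; case: (ltP (- l) _) => ?;
  case: (ltP (`|x| - l) 0); case: (ger0P x) => ? ?; case: (ger0P (x - _)) => ?; lra.
Qed.

Lemma clip_mul_sub l x : 0 <= l -> clip l x * (x - clip l x) = l * `|x - clip l x|.
Proof.
move=> l0; rewrite /clip; case: (ltP l x) => ? ; case: (ltP (- l) _) => ?;
  case: (ger0P (x - _)) => ?; nra.
Qed.

(** Subgradient inequality for l |.| at the soft-thresholded point r = x - clip l x: by
    [clip_mul_sub], clip l x is a subgradient there. *)
Lemma clip_mul_le l x y : 0 <= l ->
  clip l x * (y - (x - clip l x)) <= l * `|y| + - l * `|x - clip l x|.
Proof.
move=> l0; rewrite mulrBr mulNr clip_mul_sub// lerD2r (le_trans (ler_norm _))// normrM.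
by rewrite ler_wpM2r// norm_clip.
Qed.

Lemma shrink_ninc l l' x : l <= l' -> shrink l' x <= shrink l x.
Proof.
move=> ll; rewrite /shrink; case: (ltP (`|x| - l) 0); case: (ltP (`|x| - l') 0); lra.
Qed.

Lemma shrink_lipschitz l l' x : l <= l' -> shrink l x <= shrink l' x + (l' - l).
Proof.
move=> ll; rewrite /shrink; case: (ltP (`|x| - l) 0); case: (ltP (`|x| - l') 0); lra.
Qed.

Lemma shrink_norm_le l x : `|x| <= l -> shrink l x = 0.
Proof. by rewrite /shrink; case: (ltP (`|x| - l) 0); lra. Qed.

Variable p : nat.
Implicit Types (J : nat) (u v w : param R p).

(** Common shape of [l1n], [dist2], inner products and [evalp]: one intercept term plus a p by J
    array. Identities among them then reduce to one coordinate. *)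
Definition psum J (a : R) (b : 'I_p -> nat -> R) : R :=
  a + \sum_(k < p) \sum_(j < J) b k j.

Lemma ler_psum J a a' (b b' : 'I_p -> nat -> R) :
  a <= a' -> (forall k j, (j < J)%N -> b k j <= b' k j) -> psum J a b <= psum J a' b'.
Proof.
move=> aa bb; rewrite /psum lerD// ler_sum// => k _; rewrite ler_sum// => j _.
exact: bb.
Qed.

Lemma eq_psum J a a' (b b' : 'I_p -> nat -> R) :
  a = a' -> (forall k j, (j < J)%N -> b k j = b' k j) -> psum J a b = psum J a' b'.
Proof.
move=> aa bb; rewrite /psum aa; congr (_ + _); apply: eq_bigr => k _.
by apply: eq_bigr => j _; exact: bb.
Qed.

Lemma psumD J a a' (b b' : 'I_p -> nat -> R) :
  psum J a b + psum J a' b' = psum J (a + a') (fun k j => b k j + b' k j).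
Proof.
rewrite /psum addrACA; congr (_ + _); rewrite -big_split/=.
by apply: eq_bigr => k _; rewrite -big_split.
Qed.

Lemma psumZ J c a (b : 'I_p -> nat -> R) :
  c * psum J a b = psum J (c * a) (fun k j => c * b k j).
Proof.
rewrite /psum mulrDr; congr (_ + _); rewrite mulr_sumr.
by apply: eq_bigr => k _; rewrite mulr_sumr.
Qed.

Lemma psum_ge0 J a (b : 'I_p -> nat -> R) :
  0 <= a -> (forall k j, (j < J)%N -> 0 <= b k j) -> 0 <= psum J a b.
Proof.
move=> a0 b0; rewrite /psum addr_ge0// sumr_ge0// => k _; rewrite sumr_ge0// => j _.
exact: b0.
Qed.

Lemma psum_cst J c : psum J c (fun _ _ => c) = (1 + (p * J)%:R) * c.
Proof.
rewrite /psum; under eq_bigr do rewrite sumr_const card_ord.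
by rewrite sumr_const card_ord -mulrnA mulnC mulrDl mul1r mulr_natl.
Qed.

Lemma l1nE J u : l1n J u = psum J `|u.1| (fun k j => `|u.2 k j|).
Proof. by []. Qed.

Lemma dist2E J u v :
  dist2 J u v = psum J ((u.1 - v.1) ^+ 2) (fun k j => (u.2 k j - v.2 k j) ^+ 2).
Proof. by []. Qed.

Definition l1shrink J u l : R := psum J (shrink l u.1) (fun k j => shrink l (u.2 k j)).

Definition ip J u v : R := psum J (u.1 * v.1) (fun k j => u.2 k j * v.2 k j).

Definition psub u v : param R p := (u.1 - v.1, fun k j => u.2 k j - v.2 k j).

Lemma l1shrink_ninc J u l l' : l <= l' -> l1shrink J u l' <= l1shrink J u l.
Proof. by move=> ll; apply: ler_psum => *; exact: shrink_ninc. Qed.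

Lemma l1shrink_lipschitz J u l l' : l <= l' ->
  l1shrink J u l <= l1shrink J u l' + (1 + (p * J)%:R) * (l' - l).
Proof.
by move=> ll; rewrite -psum_cst psumD; apply: ler_psum => *; exact: shrink_lipschitz.
Qed.

Lemma norm_le_l1n J u : `|u.1| <= l1n J u.
Proof.
by rewrite /l1n lerDl sumr_ge0// => k _; rewrite sumr_ge0.
Qed.

Lemma norm2_le_l1n J u k j : (j < J)%N -> `|u.2 k j| <= l1n J u.
Proof.
move=> jJ; rewrite /l1n (bigD1 k)//= (bigD1 (Ordinal jJ))//=.
have h1 : 0 <= \sum_(i < J | i != Ordinal jJ) `|u.2 k i| by rewrite sumr_ge0.
have h2 : 0 <= \sum_(i < p | i != k) \sum_(j < J) `|u.2 i j|.
  by rewrite sumr_ge0// => i _; rewrite sumr_ge0.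
have := normr_ge0 u.1; lra.
Qed.

Lemma l1shrink_l1n J u : l1shrink J u (l1n J u) = 0.
Proof.
rewrite /l1shrink /psum shrink_norm_le ?norm_le_l1n// add0r big1// => k _.
by rewrite big1// => j _; rewrite shrink_norm_le// norm2_le_l1n.
Qed.

(* The threshold of the soft-thresholding formula for the l1-projection. *)
Definition l1thr J (Rad : R) u : R := inf [set l | 0 <= l /\ l1shrink J u l <= Rad].

Section threshold.
Variables (J : nat) (Rad : R) (Rad0 : 0 < Rad) (u : param R p).

Let L := [set l | 0 <= l /\ l1shrink J u l <= Rad].

Let L_inf : has_inf L.
Proof.
split; last by exists 0 => l [].
by exists (l1n J u); split; [exact: le_trans (norm_le_l1n J u)|rewrite l1shrink_l1n ltW].
Qed.

Lemma l1thr_ge0 : 0 <= l1thr J Rad u.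
Proof. by apply: lb_le_inf; [exact: L_inf.1|move=> l []]. Qed.

Let cst_gt0 : 0 < 1 + (p * J)%:R :> R.
Proof. by rewrite ltr_pwDl. Qed.

(** The infimum is attained: a feasible level within e / (1 + pJ) of it changes [l1shrink] by at
    most e. *)
Lemma l1shrink_thr_le : l1shrink J u (l1thr J Rad u) <= Rad.
Proof.
apply/ler_addgt0Pr => e e0.
have [l [l0 lR] ll] := inf_adherent (divr_gt0 e0 cst_gt0) L_inf.
have tl : l1thr J Rad u <= l by apply: ge_inf; [exact: L_inf.2|split].
apply: le_trans (l1shrink_lipschitz J u tl) _; rewrite lerD//.
rewrite mulrC -ler_pdivlMr// lerBlDl; exact: ltW.
Qed.

(** This equivalence turns the level sets of the threshold in u into level sets of [l1shrink], which
    is how the threshold is shown to be measurable. *)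
Lemma l1thr_leP l : 0 <= l -> (l1thr J Rad u <= l) = (l1shrink J u l <= Rad).
Proof.
move=> l0; apply/idP/idP => [tl|lR]; last by apply: ge_inf; [exact: L_inf.2|split].
exact: le_trans (l1shrink_ninc J u tl) l1shrink_thr_le.
Qed.

(** Complementary slackness. If the threshold t is positive, every smaller level t - d violates the
    constraint, and the Lipschitz bound lets d tend to 0; capping d by t keeps t - d among the
    nonnegative levels. *)
Lemma l1thr_mul : l1thr J Rad u * l1shrink J u (l1thr J Rad u) = l1thr J Rad u * Rad.
Proof.
have := l1thr_ge0; rewrite le_eqVlt => /predU1P[<-|t0]; first by rewrite !mul0r.
congr (_ * _); apply/eqP; rewrite eq_le l1shrink_thr_le/=.
set t := l1thr J Rad u in t0 *.
apply/ler_addgt0Pr => e e0.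
pose d := Num.min t (e / (1 + (p * J)%:R)).
have d0 : 0 < d by rewrite lt_min t0 divr_gt0.
have td : t - d <= t by lra.
have td0 : 0 <= t - d by rewrite subr_ge0 ge_min lexx.
have := l1thr_leP td0; rewrite -/t.
have -> : (t <= t - d) = false by apply/negbTE; rewrite -ltNge; lra.
move/esym/negbT; rewrite -ltNge => /ltW h.
apply: le_trans h _; apply: le_trans (l1shrink_lipschitz J u td) _.
rewrite lerD2l mulrC -ler_pdivlMr//.
have -> : t - (t - d) = d by lra.
by rewrite ge_min lexx orbT.
Qed.

Definition l1soft : param R p :=
  (u.1 - clip (l1thr J Rad u) u.1,
   fun k j => if (j < J)%N then u.2 k j - clip (l1thr J Rad u) (u.2 k j) else 0).

Lemma supported_l1soft : supported J l1soft.
Proof. by move=> k j Jj; rewrite /l1soft/= ltnNge Jj. Qed.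

Lemma l1n_l1soft : l1n J l1soft = l1shrink J u (l1thr J Rad u).
Proof.
rewrite l1nE; apply: eq_psum => [|k j jJ] /=; first by rewrite norm_sub_clip// l1thr_ge0.
by rewrite jJ norm_sub_clip// l1thr_ge0.
Qed.

(** Since u minus its soft-thresholding v is the vector of clips, summing the subgradient
    inequalities bounds the inner product by t (|w|_1 - |v|_1), which is at most t (Rad - |v|_1) = 0
    by complementary slackness. *)
Lemma l1soft_variational w : l1n J w <= Rad -> ip J (psub u l1soft) (psub w l1soft) <= 0.
Proof.
move=> wR; set t := l1thr J Rad u.
have t0 : 0 <= t by exact: l1thr_ge0.
apply: (@le_trans _ _ (t * l1n J w + (- t) * l1n J l1soft)); last first.
  have e : t * l1n J l1soft = t * Rad by rewrite l1n_l1soft; exact: l1thr_mul.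
  by rewrite [X in _ + X]mulNr e subr_le0 ler_wpM2l.
have key x y := @clip_mul_le t x y t0.
rewrite !l1nE !psumZ psumD.
apply: ler_psum => [|k j jJ]; first by rewrite /= subKr key.
by rewrite /= jJ subKr key.
Qed.

(** Pythagorean inequality. It yields minimality, uniqueness of the minimiser, and the contraction
    towards feasible points used by the algorithm. *)
Lemma dist2_l1soft w : l1n J w <= Rad ->
  dist2 J u l1soft + dist2 J l1soft w <= dist2 J u w.
Proof.
move=> /l1soft_variational h.
suff -> : dist2 J u w = dist2 J u l1soft + dist2 J l1soft w
    + (- 2) * ip J (psub u l1soft) (psub w l1soft).
  by rewrite lerDl mulNr oppr_ge0 mulr_ge0_le0.
rewrite /ip psumZ !dist2E !psumD; apply: eq_psum => [|k j jJ] /=; ring.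
Qed.

End threshold.

Lemma dist2_ge0 J u v : 0 <= dist2 J u v.
Proof. by rewrite dist2E; apply: psum_ge0 => *; exact: sqr_ge0. Qed.

Lemma dist2_eq0 J u v : supported J u -> supported J v -> dist2 J u v <= 0 -> u = v.
Proof.
move=> su sv; rewrite le_eqVlt ltNge dist2_ge0 orbF /dist2.
rewrite paddr_eq0 ?sqr_ge0//; last first.
  by rewrite sumr_ge0// => k _; rewrite sumr_ge0// => j _; exact: sqr_ge0.
rewrite sqrf_eq0 subr_eq0 => /andP[/eqP e1].
rewrite psumr_eq0/=; last by move=> k _; rewrite sumr_ge0// => j _; exact: sqr_ge0.
move=> /allP e2; case: u v su sv e1 e2 => [u1 u2] [v1 v2] /= su sv -> e2.
congr pair; apply/funext => k; apply/funext => j.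
have [jJ|Jj] := ltnP j J; last by rewrite [LHS](su _ _ Jj) [RHS](sv _ _ Jj).
have := e2 k (mem_index_enum k); rewrite psumr_eq0/=; last by move=> i _; exact: sqr_ge0.
by move=> /allP/(_ (Ordinal jJ) (mem_index_enum _)); rewrite sqrf_eq0 subr_eq0 => /eqP.
Qed.

(** [l1soft] witnesses that a minimiser exists, so [epsilon] returns one; the Pythagorean inequality
    puts any two minimisers at distance 0. Support in J coordinates upgrades this to equality of
    functions. *)
Lemma l1projE J Rad u : 0 < Rad -> l1proj J Rad u = l1soft J Rad u.
Proof.
move=> R0; have s0 : supported J (l1soft J Rad u) by exact: supported_l1soft.
have s1 : l1n J (l1soft J Rad u) = l1shrink J u (l1thr J Rad u) by exact: l1n_l1soft.
have s2 : is_l1proj J Rad u (l1soft J Rad u).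
  split => //; first by rewrite s1 l1shrink_thr_le.
  move=> w _ /(dist2_l1soft R0 u) h; apply: le_trans h.
  by rewrite lerDl dist2_ge0.
have : is_l1proj J Rad u (l1proj J Rad u).
  by apply: (epsilon_spec (inhabits (param0 R p))); exists (l1soft J Rad u).
case=> su lR hmin; apply: (dist2_eq0 su s0).
have := dist2_l1soft R0 u lR; have := hmin _ s0.
rewrite s1 l1shrink_thr_le// => /(_ isT) h1 h2.
suff -> : dist2 J (l1proj J Rad u) (l1soft J Rad u) =
          dist2 J (l1soft J Rad u) (l1proj J Rad u) by lra.
by rewrite !dist2E; apply: eq_psum => *; rewrite -sqrrN opprB.
Qed.

Lemma supported_l1proj J Rad u : 0 < Rad -> supported J (l1proj J Rad u).
Proof. by move=> R0; rewrite l1projE//; exact: supported_l1soft. Qed.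

Lemma l1n_l1proj J Rad u : 0 < Rad -> l1n J (l1proj J Rad u) <= Rad.
Proof. by move=> R0; rewrite l1projE// l1n_l1soft// l1shrink_thr_le. Qed.

Lemma dist2_l1proj J Rad u w : 0 < Rad -> l1n J w <= Rad ->
  dist2 J (l1proj J Rad u) w <= dist2 J u w.
Proof.
move=> R0 wR; rewrite l1projE//; apply: le_trans (dist2_l1soft R0 _ wR).
by rewrite lerDr dist2_ge0.
Qed.

(** * Measurability of the iterates as functions of the data *)

Section measurability.
Context d (T : measurableType d).

(** Measurability is imposed coordinatewise, so that no sigma-algebra on the function space inside
    [param] has to be chosen; every formula involved reads only finitely many coordinates. *)
Definition mparam (u : T -> param R p) : Prop :=
  measurable_fun setT (fun a => (u a).1) /\
  (forall k j, measurable_fun setT (fun a => (u a).2 k j)).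

Lemma measurable_psum J (a : T -> R) (b : T -> 'I_p -> nat -> R) :
  measurable_fun setT a -> (forall k j, measurable_fun setT (fun z => b z k j)) ->
  measurable_fun setT (fun z => psum J (a z) (b z)).
Proof.
move=> ma mb; apply: measurable_funD => //.
by apply: measurable_sum => k; apply: measurable_sum => j; exact: mb.
Qed.

Lemma measurable_l1shrink J (u : T -> param R p) l : mparam u ->
  measurable_fun setT (fun a => l1shrink J (u a) l).
Proof.
case=> mu1 mu2; apply: measurable_psum => [|k j]; apply: measurable_maxr => //;
  by apply: measurable_funB => //; exact: measurableT_comp.
Qed.

(** It suffices to look at preimages of open upper rays. Those starting below 0 are everything,
    because the threshold is nonnegative; the others are superlevel sets of [l1shrink] at a fixed
    level. *)
Lemma measurable_l1thr J Rad (u : T -> param R p) : 0 < Rad -> mparam u ->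
  measurable_fun setT (fun a => l1thr J Rad (u a)).
Proof.
move=> R0 mu _; apply: (measurability _ (RGenOInfty.measurableE R)) => //.
move=> _ [_ [x ->] <-]; rewrite setTI.
have [x0|x0] := ltP x 0.
  rewrite (_ : _ @^-1` _ = setT)//; apply/seteqP; split=> // a _ /=.
  by rewrite in_itv/= andbT (lt_le_trans x0)// l1thr_ge0.
rewrite (_ : _ @^-1` _ = (fun a => l1shrink J (u a) x) @^-1` `]Rad, +oo[).
  by rewrite -[X in measurable X]setTI; apply: measurable_l1shrink.
by apply/seteqP; split=> a /=; rewrite !in_itv/= !andbT !ltNge l1thr_leP.
Qed.

Lemma measurable_clip (l x : T -> R) : measurable_fun setT l -> measurable_fun setT x ->
  measurable_fun setT (fun a => clip (l a) (x a)).
Proof.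
move=> ml mx; apply: measurable_maxr; first exact: measurableT_comp.
exact: measurable_minr.
Qed.

Lemma mparam_l1proj J Rad (u : T -> param R p) : 0 < Rad -> mparam u ->
  mparam (fun a => l1proj J Rad (u a)).
Proof.
move=> R0 mu; have mt := measurable_l1thr J R0 mu; case: mu => mu1 mu2.
have -> : (fun a => l1proj J Rad (u a)) = (fun a => l1soft J Rad (u a)).
  by apply/funext => a; exact: l1projE.
split=> [|k j] /=; first by apply: measurable_funB => //; exact: measurable_clip.
by case: (j < J)%N => //; apply: measurable_funB => //; exact: measurable_clip.
Qed.

Lemma measurable_evalp (psi : 'I_p -> nat -> R -> R) J (u : T -> param R p)
    (x : T -> p.-tuple R) :
  (forall k j, measurable_fun setT (psi k j)) -> mparam u -> measurable_fun setT x ->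
  measurable_fun setT (fun a => evalp psi J (u a) (x a)).
Proof.
move=> mpsi [mu1 mu2] mx.
apply: (measurable_psum J (a := fun a => (u a).1)
  (b := fun a k j => (u a).2 k j * psi k j (tnth (x a) k))) => // k j.
apply: measurable_funM => //; apply: measurableT_comp => //.
exact: (measurableT_comp (measurable_tnth k)).
Qed.

Lemma mparam_pfgd_step tau s A Rad (psi : 'I_p -> nat -> R -> R) t
    (u : T -> param R p) (x : T -> p.-tuple R) (y : T -> R) : 0 < Rad ->
  (forall k j, measurable_fun setT (psi k j)) -> mparam u ->
  measurable_fun setT x -> measurable_fun setT y ->
  mparam (fun a => pfgd_step tau s A Rad psi t (u a) (x a) (y a)).
Proof.
move=> R0 mpsi mu mx my; apply: mparam_l1proj => //.
have mg : measurable_fun setT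
    (fun a => tau - ((y a <= evalp psi (Jt s t) (u a) (x a))%R)%:R).
  apply: measurable_funB => //.
  have mb := measurable_fun_ler my (measurable_evalp (Jt s t) mpsi mu mx).
  rewrite (_ : (fun _ => _) = fun a =>
    if (y a <= evalp psi (Jt s t) (u a) (x a))%R then 1 else 0); last first.
    by apply/funext => a; case: ifP.
  exact: measurable_fun_ifT.
case: mu => mu1 mu2; split=> [|k j] /=.
  by apply: measurable_funD => //; apply: measurable_funM.
case: (j < _)%N => //; apply: measurable_funD => //; apply: measurable_funM => //.
  exact: measurable_funM.
apply: measurableT_comp => //; exact: (measurableT_comp (measurable_tnth k)).
Qed.

(** Only the observations 1, ..., t are required to be measurable: the lemma is later applied with T
    carrying the sigma-algebra that these observations generate. *)
Lemma mparam_pfgd_theta tau s A Rad (psi : 'I_p -> nat -> R -> R)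
    (X : nat -> T -> p.-tuple R) (Y : nat -> T -> R) t : 0 < Rad ->
  (forall k j, measurable_fun setT (psi k j)) ->
  (forall i, (0 < i <= t)%N -> measurable_fun setT (X i)) ->
  (forall i, (0 < i <= t)%N -> measurable_fun setT (Y i)) ->
  mparam (fun a => pfgd_theta tau s A Rad psi (fun i => X i a) (fun i => Y i a) t).
Proof.
move=> R0 mpsi; elim: t => [|t ih] mX mY.
  by split=> [|k j]; exact: measurable_cst.
apply: mparam_pfgd_step => //; [|by apply: mX; rewrite /= leqnn|by apply: mY; rewrite /= leqnn].
by apply: ih => i /andP[i0 it]; [apply: mX|apply: mY]; rewrite i0 ltnW.
Qed.

End measurability.
End l1_projection.

(** * The uniform measure on the cube *)

Section cube_measure.
Variable R : realType.

Lemma in_cube_cons n (u : R) (v : n.-tuple R) :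
  in_cube [tuple of u :: v] <-> 0 <= u <= 1 /\ in_cube v.
Proof.
split=> [h|[hu hv] k].
  split; first by have := h ord0; rewrite tnth0.
  by move=> k; have := h (lift ord0 k); rewrite tnthS.
by case: (unliftP ord0 k) => [j ->|->]; rewrite ?tnthS ?tnth0.
Qed.

Lemma eq_cube_int n (f g : n.-tuple R -> \bar R) :
  (forall x, in_cube x -> f x = g x) -> cube_int f = cube_int g.
Proof.
elim: n f g => [|n ih] f g fg /=; first by apply: fg => -[].
apply: eq_integral => u; rewrite inE/= in_itv/= => u01.
by apply: ih => v v01; apply: fg; apply/in_cube_cons.
Qed.

(* [lebesgue_measure] and [uniform_prob] live on [measurableTypeR R], whose display
   differs from the one of the canonical structure on [R] used in the statement. *)
Definition toR (x : measurableTypeR R) : R := x.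

Lemma measurable_toR : measurable_fun setT toR.
Proof. by move=> _ A mA; rewrite setTI. Qed.

HB.instance Definition _ := isMeasurableFun.Build _ _ _ _ toR measurable_toR.

Definition leb : set R -> \bar R := pushforward (@lebesgue_measure R) toR.

Let leb0 : leb set0 = 0%E.
Proof. by rewrite /leb /pushforward preimage_set0 measure0. Qed.

Let leb_ge0 U : (0 <= leb U)%E.
Proof. exact: measure_ge0. Qed.

Let leb_sigma_additive : semi_sigma_additive leb.
Proof. exact: (@measure_semi_sigma_additive _ _ _ (@lebesgue_measure R)). Qed.

HB.instance Definition _ := isMeasure.Build _ _ _ leb leb0 leb_ge0 leb_sigma_additive.

Let leb_sigma_finite : sigma_finite setT leb.
Proof. exact: (@sigma_finiteT _ _ _ (@lebesgue_measure R)). Qed.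

HB.instance Definition _ := Measure_isSigmaFinite.Build _ _ _ leb leb_sigma_finite.

Lemma integral_leb (D : set R) (f : R -> \bar R) : measurable D ->
  measurable_fun D f -> (forall y, D y -> 0 <= f y)%E ->
  (\int[leb]_(y in D) f y = \int[@lebesgue_measure R]_(y in D) f y)%E.
Proof.
move=> mD mf f0; transitivity (\int[pushforward (@lebesgue_measure R) toR]_(y in D) f y)%E => //.
rewrite (ge0_integral_pushforward measurable_toR)//.
by move=> y /set_mem; exact: f0.
Qed.

Definition unif01 : probability R R := distribution (uniform_prob (@ltr01 R)) toR.

Lemma integral_unif01 (f : R -> \bar R) : measurable_fun setT f -> (forall y, 0 <= f y)%E ->
  (\int[unif01]_y f y = \int[@lebesgue_measure R]_(y in `[0%R, 1%R]) f y)%E.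
Proof.
move=> mf f0; rewrite ge0_integral_distribution// integral_uniform//.
by rewrite subr0 invr1 mul1e.
Qed.

Section cons_prob.
Variables (n : nat) (m : probability (n.-tuple R) R).

Definition tcons (z : R * n.-tuple R) : n.+1.-tuple R := [tuple of z.1 :: z.2].

Lemma measurable_tcons : measurable_fun setT tcons.
Proof. exact: measurable_cons. Qed.

Definition cons_measure : set (n.+1.-tuple R) -> \bar R :=
  pushforward (unif01 \x m)%E tcons.

Let cons0 : cons_measure set0 = 0%E.
Proof. by rewrite /cons_measure /pushforward preimage_set0 measure0. Qed.

Let cons_ge0 U : (0 <= cons_measure U)%E.
Proof. exact: (measure_ge0 (unif01 \x m)%E). Qed.

Let cons_sigma_additive : semi_sigma_additive cons_measure.
Proof.
move=> F mF tF mUF; rewrite /cons_measure /pushforward preimage_bigcup.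
apply: measure_semi_sigma_additive.
- by move=> i; rewrite -[X in measurable X]setTI; exact: measurable_tcons.
- apply/trivIsetP => /= i j _ _ ij; rewrite -preimage_setI.
  by move/trivIsetP : tF => /(_ i j Logic.I Logic.I ij) ->; rewrite preimage_set0.
- by rewrite -preimage_bigcup -[X in measurable X]setTI; exact: measurable_tcons.
Qed.

HB.instance Definition _ := isMeasure.Build _ _ _ cons_measure
  cons0 cons_ge0 cons_sigma_additive.

Let cons_setT : cons_measure setT = 1%E.
Proof.
rewrite /cons_measure /pushforward preimage_setT -setXTT.
transitivity (unif01 setT * m setT)%E; first exact: product_measure1E.
by rewrite !probability_setT mule1.
Qed.

HB.instance Definition _ := @Measure_isProbability.Build _ _ R cons_measure cons_setT.

Definition cons_prob : probability (n.+1.-tuple R) R := cons_measure.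

End cons_prob.

(** A single probability measure behind the iterated integral [cube_int], which gives access to
    linearity, dominated convergence and Tonelli in p variables. *)
Fixpoint cube_prob n : probability (n.-tuple R) R :=
  if n is n'.+1 then cons_prob (cube_prob n') else dirac [tuple].

Lemma cube_int_setT n (f : n.-tuple R -> \bar R) : measurable_fun setT f ->
  (forall x, 0 <= f x)%E -> cube_int f = (\int[cube_prob n]_x f x)%E.
Proof.
elim: n f => [|n ih] f mf f0 /=.
  by rewrite integral_dirac//= diracT mul1e.
have mft : measurable_fun setT (f \o @tcons n).
  exact: (measurableT_comp mf (@measurable_tcons n)).
rewrite [RHS](_ : _ = (\int[pushforward (unif01 \x cube_prob n) (@tcons n)]_x f x)%E)//.
rewrite (ge0_integral_pushforward (@measurable_tcons n))//.
rewrite preimage_setT fubini_tonelli1//= integral_unif01//; last 2 first.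
- by apply: (measurable_fun_fubini_tonelli_F (f \o @tcons n)) => // z; exact: f0.
- by move=> u; apply: integral_ge0 => v _; exact: f0.
apply: eq_integral => u _.
rewrite ih//; exact: (measurableT_comp mft (pair1_measurable u)).
Qed.

Definition cube n : set (n.-tuple R) := [set x | in_cube x].

Lemma measurable_cube n : measurable (@cube n).
Proof.
rewrite (_ : @cube n = \bigcap_(k in [set: 'I_n]) ((fun x => tnth x k) @^-1` `[0%R, 1%R])).
  apply: fin_bigcap_measurable => // k _; rewrite -[X in measurable X]setTI.
  exact: measurable_tnth.
apply/seteqP; split=> x /=; first by move=> h k _ /=; rewrite in_itv/=.
by move=> h k; have := h k Logic.I; rewrite /= in_itv.
Qed.

(** The assumptions on f are confined to the cube, as are those on the densities and on q; extension
    by zero reduces to [cube_int_setT]. *)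
Lemma cube_intE n (f : n.-tuple R -> \bar R) : measurable_fun (@cube n) f ->
  (forall x, in_cube x -> 0 <= f x)%E ->
  cube_int f = (\int[cube_prob n]_(x in @cube n) f x)%E.
Proof.
move=> mf f0; rewrite integral_mkcond -cube_int_setT.
- apply: eq_cube_int => x xc; rewrite patchE; case: ifPn => //.
  by rewrite notin_setE.
- by apply/(measurable_restrictT _ _).1 => //; exact: measurable_cube.
- by move=> x; apply: erestrict_ge0.
Qed.

Lemma cube_prob_cube n : cube_prob n (@cube n) = 1%E.
Proof.
have -> : cube_prob n (@cube n) = cube_int (fun _ : n.-tuple R => 1%E).
  rewrite (cube_intE (n := n))// integral_cst ?mul1e//; exact: measurable_cube.
elim: n => [//|n ih] /=; under eq_integral do rewrite ih.
by rewrite integral_cst//= mul1e lebesgue_measure_itv/= lte_fin ltr01 -EFinB subr0.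
Qed.

End cube_measure.

(** * Quantiles of a density *)

Section quantile.
Variables (R : realType) (f : R -> R).
Hypothesis mf : measurable_fun setT f.
Hypothesis f0 : forall y, 0 <= f y.
Local Notation mu := (@lebesgue_measure R).
Hypothesis f1 : (\int[mu]_y (f y)%:E = 1)%E.

Let I (D : set R) : \bar R := (\int[mu]_(y in D) (f y)%:E)%E.

Let mfE (D : set R) : measurable_fun (D : set (measurableTypeR R)) (EFin \o f).
Proof. apply: measurable_funTS; apply/measurable_EFinP; exact: mf. Qed.

Let I_ge0 D : (0 <= I D)%E.
Proof. by apply: integral_ge0 => y _; rewrite lee_fin. Qed.

Let I_subset (D E : set R) : measurable D -> measurable E -> D `<=` E -> (I D <= I E)%E.
Proof. by move=> mD mE DE; apply: ge0_subset_integral => //= y _; rewrite lee_fin. Qed.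

Let I_le1 (D : set R) : measurable D -> (I D <= 1)%E.
Proof. by move=> mD; rewrite -f1; exact: I_subset. Qed.

Let I_fin (D : set R) : measurable D -> I D \is a fin_num.
Proof. by move=> mD; rewrite ge0_fin_numE// (le_lt_trans (I_le1 mD))// ltry. Qed.

(** Continuity from below in the form of a bound. The limits of the cdf at both infinities and its
    one-sided continuity all come from it, decreasing limits being rewritten as increasing unions of
    complements. *)
Let I_bigcup_le (S : (set R)^nat) (D : set R) (c : \bar R) : measurable D ->
  (forall n, measurable (S n)) -> nondecreasing_seq S ->
  (forall n, I (S n) <= c)%E -> D `<=` \bigcup_n S n -> (I D <= c)%E.
Proof.
move=> mD mS ndS Sc DS.
apply: (@le_trans _ _ (I (\bigcup_n S n))).
  by apply: I_subset => //; exact: bigcup_measurable.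
have h := @ge0_nondecreasing_set_cvg_integral _ (measurableTypeR R) R S (EFin \o f) mu ndS mS
  (fun n => @mfE (S n)) (fun n y _ => f0 y).
have -> : I (\bigcup_n S n) = limn (fun n => I (S n)) by exact/esym/cvg_lim.
apply: lime_le; first by apply/cvg_ex; eexists; exact: h.
by near=> n; exact: Sc.
Unshelve. all: by end_near. Qed.

Let I_oc (a b : R) : a <= b -> (I `]-oo, b] = I `]-oo, a] + I `]a, b])%E.
Proof.
move=> ab; rewrite /I -ge0_integral_setU//=; last 2 first.
- by move=> y _; rewrite lee_fin.
- apply/disj_setPS => y [/=]; rewrite !in_itv/= => ya /andP[].
  by rewrite ltNge ya.
- congr (integral _ _ _); apply/seteqP; split=> y /=; rewrite !in_itv/=.
    by move=> yb; rewrite yb andbT; have [] := leP y a; [left|right].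
  by case=> [/le_trans->//|/andP[]].
Qed.

Let I_split (v : R) : (I `]-oo, v] + I `]v, +oo[ = 1)%E.
Proof.
rewrite /I -ge0_integral_setU//=; last 2 first.
- by move=> y _; rewrite lee_fin.
- apply/disj_setPS => y [/=]; rewrite !in_itv/= andbT => ya.
  by rewrite ltNge ya.
rewrite -f1; congr (integral _ _ _); apply/seteqP; split=> y //= _; rewrite !in_itv/= andbT.
by have [] := leP y v; [left|right].
Qed.

Let I_mono (a b : R) : a <= b -> (I `]-oo, a] <= I `]-oo, b])%E.
Proof.
by move=> ab; apply: I_subset => // y /=; rewrite !in_itv/= => /le_trans; apply.
Qed.

(** The updated parameter depends on Y only through the indicator of Y <= v, so its risk takes two
    values as a function of Y and its conditional mean involves the law of Y only through F(v). *)
Lemma integral_step_density (v Fv r0 r1 : R) : I `]-oo, v] = Fv%:E ->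
  0 <= r0 -> 0 <= r1 ->
  (\int[mu]_y ((if y <= v then r1 else r0) * f y)%:E = (r1 * Fv + r0 * (1 - Fv))%:E)%E.
Proof.
move=> IF r00 r10.
have Iy : I `]v, +oo[ = (1 - Fv)%:E.
  have := I_split v; rewrite IF -(fineK (I_fin (measurable_itv `]v, +oo[))) -EFinD => -[e].
  by congr (_%:E); lra.
rewrite (_ : setT = `]-oo, v] `|` `]v, +oo[); last first.
  apply/seteqP; split=> y //= _; rewrite !in_itv/= andbT.
  by have [] := leP y v; [left|right].
have mz : measurable_fun setT (fun y : R => if y <= v then r1 else r0).
  by apply: measurable_fun_ifT => //; exact: measurable_fun_ler.
rewrite ge0_integral_setU//=; last 3 first.
- by apply/measurable_EFinP/measurable_funTS; exact: (measurable_funM mz mf).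
- by move=> y _; rewrite lee_fin mulr_ge0//; case: ifP.
- by apply/disj_setPS => y [/=]; rewrite !in_itv/= andbT => ya; rewrite ltNge ya.
rewrite EFinD !EFinM -IF -Iy; congr (_ + _)%E.
- rewrite /I -ge0_integralZl//=; last by move=> y _; rewrite lee_fin.
  by apply: eq_integral => y; rewrite inE/= in_itv/= => ->.
- rewrite /I -ge0_integralZl//=; last by move=> y _; rewrite lee_fin.
  by apply: eq_integral => y; rewrite inE/= in_itv/= andbT ltNge => /negbTE ->.
Qed.

Variables (tau : R).
Hypothesis tau01 : 0 < tau < 1.

Let L := [set v : R | (tau%:E <= I `]-oo, v])%E].

Let nd_itv (u : nat -> R) : {homo u : n m / (n <= m)%N >-> n <= m} ->
  nondecreasing_seq (fun n => `]-oo, u n]%classic : set R).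
Proof.
move=> nu m n mn; apply/subsetPset => y /=; rewrite !in_itv/= => /le_trans; apply.
exact: nu.
Qed.

Let nd_itvy (u : nat -> R) : {homo u : n m / (n <= m)%N >-> m <= n} ->
  nondecreasing_seq (fun n => `]u n, +oo[%classic : set R).
Proof.
move=> nu m n mn; apply/subsetPset => y /=; rewrite !in_itv/= !andbT; apply: le_lt_trans.
exact: nu.
Qed.

Let I_compl v : (tau%:E <= I `]-oo, v])%E -> (I `]v, +oo[ <= (1 - tau)%:E)%E.
Proof.
have := I_split v; rewrite -(fineK (I_fin (measurable_itv `]-oo, v]))).
rewrite -(fineK (I_fin (measurable_itv `]v, +oo[))) -EFinD => -[]; rewrite !lee_fin; lra.
Qed.

(** If L were empty the cdf would stay at or below tau, against its limit 1; if L were unbounded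
    below the cdf would stay at or above tau, against its limit 0. *)
Let has_inf_L : has_inf L.
Proof.
split.
  apply: contrapT => /forallNP nL.
  have : (I setT <= tau%:E)%E.
    apply: (@I_bigcup_le (fun n => `]-oo, n%:R]%classic)) => //.
    - by apply: nd_itv => m n mn; rewrite ler_nat.
    - by move=> n; rewrite leNgt; apply/negP => /ltW /nL.
    - move=> y _; exists (Num.truncn `|y|).+1 => //=; rewrite in_itv/=.
      by rewrite (le_trans (ler_norm _))// ltW// truncnS_gt.
  by rewrite /I f1 lee_fin; move: tau01 => /andP[? ?] ?; lra.
apply: contrapT => nL.
have : (I setT <= (1 - tau)%:E)%E.
  apply: (@I_bigcup_le (fun n => `](- n%:R), +oo[%classic)) => //.
  - by apply: nd_itvy => m n mn; rewrite lerN2 ler_nat.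
  - move=> n; apply: I_compl; rewrite leNgt; apply/negP => h; apply: nL.
    exists (- n%:R) => v Lv; rewrite leNgt; apply/negP => vn.
    by have := le_lt_trans (le_trans Lv (I_mono (ltW vn))) h; rewrite ltxx.
  - move=> y _; exists (Num.truncn `|y|).+1 => //=; rewrite in_itv/= andbT ltrNl.
    by rewrite (le_lt_trans (ler_norm _))// normrN truncnS_gt.
by rewrite /I f1 lee_fin; move: tau01 => /andP[? ?] ?; lra.
Qed.

Lemma cdf_inf : I `]-oo, inf L] = tau%:E.
Proof.
set q := inf L; apply/eqP; rewrite eq_le; apply/andP; split.
  (* A density charges no point, so the right end may be opened; the open ray is exhausted by rays
     ending strictly below q, hence outside L. *)
  rewrite /I -integral_itv_bndo_bndc; last exact: mfE.
  apply: (@I_bigcup_le (fun n => `]-oo, (q - n.+1%:R^-1)]%classic)) => //.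
  - by apply: nd_itv => m n mn; rewrite lerD2l lerN2 lef_pV2 ?posrE// ler_nat.
  - move=> n; rewrite leNgt; apply/negP => /ltW Ln.
    have e0 : 0 < n.+1%:R^-1 :> R by rewrite invr_gt0.
    have absurd (a b : R) : 0 < b -> a <= a - b -> False by lra.
    exact: absurd e0 (ge_inf has_inf_L.2 Ln).
  - move=> y /=; rewrite in_itv/= => /ltr_add_invr[k yk].
    by exists k => //=; rewrite in_itv/= lerBrDr ltW.
(* Right continuity, on the complementary side: every level above q dominates an element of L. *)
have : (I `]q, +oo[ <= (1 - tau)%:E)%E.
  apply: (@I_bigcup_le (fun n => `](q + n.+1%:R^-1), +oo[%classic)) => //.
  - by apply: nd_itvy => m n mn; rewrite lerD2l lef_pV2 ?posrE// ler_nat.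
  - move=> n; apply: I_compl.
    have e0 : 0 < n.+1%:R^-1 :> R by rewrite invr_gt0.
    have [l Ll lq] := inf_adherent e0 has_inf_L.
    exact: le_trans Ll (I_mono (ltW lq)).
  - move=> y /=; rewrite in_itv/= andbT => /ltr_add_invr[k yk].
    by exists k => //=; rewrite in_itv/= andbT.
have := I_split q; rewrite -(fineK (I_fin (measurable_itv `]-oo, q]))).
rewrite -(fineK (I_fin (measurable_itv `]q, +oo[))) -EFinD => -[]; rewrite !lee_fin; lra.
Qed.

Variables (B c1 c2 : R).
Hypothesis c1_ge0 : 0 <= c1.
Hypothesis fB : forall y, - B <= y <= B -> c1 <= f y <= c2.

Let I_oc_bnd a b : - B <= a -> a <= b -> b <= B ->
  ((c1 * (b - a))%:E <= I `]a, b] <= (c2 * (b - a))%:E)%E.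
Proof.
move=> Ba ab bB.
have mab : mu `]a, b] = (b - a)%:E.
  rewrite lebesgue_measure_itv/= lte_fin; case: ltP => // ba.
  by have /eqP -> : b == a; rewrite ?eq_le ?ba// subrr.
have fab y : `]a, b]%classic y -> c1 <= f y <= c2.
  rewrite /= in_itv/= => /andP[/ltW ay yb]; apply: fB.
  by rewrite (le_trans Ba ay) (le_trans yb bB).
apply/andP; split; rewrite EFinM -mab -integral_cst//; apply: ge0_le_integral => //.
- by move=> y /fab/andP[h _]; rewrite lee_fin.
- by move=> y _; rewrite lee_fin.
- by move=> y /fab/andP[_ h]; rewrite lee_fin.
Qed.

(** As F(q) = tau, the difference of F(v) and tau is, up to sign, the mass between v and q. Both
    points lie in [-B, B], so this mass is between c1 |v - q| and c2 |v - q|. *)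
Lemma cdf_quantile_bounds v : - B <= v <= B -> - B <= inf L <= B ->
  exists Fv, [/\ I `]-oo, v] = Fv%:E, 0 <= Fv <= 1,
    (tau - Fv) * (v - inf L) <= - (c1 * (v - inf L) ^+ 2) &
    `|tau - Fv| <= c2 * `|v - inf L|].
Proof.
move=> /andP[Bv vB]; move: (inf L) cdf_inf => q Iq /andP[Bq qB].
have Iv : I `]-oo, v] = (fine (I `]-oo, v]))%:E by rewrite fineK// I_fin.
have F01 : 0 <= fine (I `]-oo, v]) <= 1 by rewrite fine_ge0//= -lee_fin -Iv I_le1.
exists (fine (I `]-oo, v])); move: (fine _) Iv F01 => F Iv F01; split => //.
- have [qv|/ltW vq] := leP q v.
    have /andP[] := I_oc_bnd Bq qv vB; have := I_oc qv.
    rewrite Iq Iv -(fineK (I_fin (measurable_itv `]q, v]))) -EFinD !lee_fin => -[].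
    move=> ->; set z := fine _ => h1 h2.
    rewrite [leRHS](_ : _ = - (c1 * (v - q)) * (v - q)); last by ring.
    rewrite ler_wpM2r ?subr_ge0//; lra.
  have /andP[] := I_oc_bnd Bv vq qB; have := I_oc vq.
  rewrite Iq Iv -(fineK (I_fin (measurable_itv `]v, q]))) -EFinD !lee_fin => -[].
  move=> ->; set z := fine _ => h1 h2.
  rewrite [leRHS](_ : _ = (c1 * (q - v)) * (v - q)); last by ring.
  rewrite ler_wnM2r ?subr_le0//; lra.
- have [qv|/ltW vq] := leP q v.
    have /andP[] := I_oc_bnd Bq qv vB; have := I_oc qv.
    rewrite Iq Iv -(fineK (I_fin (measurable_itv `]q, v]))) -EFinD !lee_fin => -[].
    move=> ->; set z := fine _ => h1 h2.
    have z0 : 0 <= z by apply: fine_ge0.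
    by rewrite opprD addrA subrr sub0r normrN ger0_norm// ger0_norm ?subr_ge0.
  have /andP[] := I_oc_bnd Bv vq qB; have := I_oc vq.
  rewrite Iq Iv -(fineK (I_fin (measurable_itv `]v, q]))) -EFinD !lee_fin => -[].
  move=> ->; set z := fine _ => h1 h2.
  have z0 : 0 <= z by apply: fine_ge0.
  by rewrite addrC addKr ger0_norm// ler0_norm ?subr_le0// opprB.
Qed.

End quantile.

(** * Densities and independence *)

Section density.
Local Open Scope ereal_scope.
Context d (T : measurableType d) (R : realType).
Variables (m nu : {measure set T -> \bar R}) (h : T -> R).
Hypothesis mh : measurable_fun setT h.
Hypothesis h0 : forall x, (0 <= h x)%R.
Hypothesis nuE : forall B, measurable B -> nu B = \int[m]_x ((\1_B x)%:E * (h x)%:E).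

Import HBNNSimple.

Let integral_density_nnsfun (f : {nnsfun T >-> R}) :
  \int[nu]_x (f x)%:E = \int[m]_x ((f x)%:E * (h x)%:E).
Proof.
under [LHS]eq_integral do rewrite fimfunE -fsumEFin//.
rewrite [LHS]ge0_integral_fsum//; last 2 first.
  - by move=> r; exact/measurable_EFinP/measurableT_comp.
  - by move=> n x _; rewrite EFinM nnfun_muleindic_ge0.
under [RHS]eq_integral.
  move=> x xD; rewrite fimfunE -fsumEFin// ge0_mule_fsuml; last first.
    by move=> r; rewrite EFinM nnfun_muleindic_ge0.
  over.
rewrite [RHS]ge0_integral_fsum//; last 2 first.
  - move=> r; apply: emeasurable_funM; last exact/measurable_EFinP.
    exact/measurable_EFinP/measurableT_comp.
  - by move=> n x _; rewrite mule_ge0 ?lee_fin// -lee_fin EFinM nnfun_muleindic_ge0.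
apply: eq_fsbigr => r _; rewrite integralZl_indic_nnsfun// integral_indic// setIT.
(* The sum ranges over all reals; a negative level has empty preimage because f is nonnegative. *)
have [r0|r0] := leP 0%R r; last first.
  have e : f @^-1` [set r] = set0.
    by apply/seteqP; split=> // x /= fx; have : (0 <= f x)%R by []; rewrite fx leNgt r0.
  by rewrite e measure0 mule0 integral0_eq// => x _; rewrite indic0 mulr0 mul0e.
rewrite nuE// -ge0_integralZl//.
- by apply: eq_integral => x _; rewrite EFinM muleA.
- by apply: emeasurable_funM; exact/measurable_EFinP.
- by move=> x _; rewrite mule_ge0// lee_fin.
Qed.

Lemma ge0_integral_density (f : T -> \bar R) : measurable_fun setT f ->
  (forall x, 0 <= f x) -> \int[nu]_x f x = \int[m]_x (f x * (h x)%:E).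
Proof.
move=> mf f0; pose g := nnsfun_approx measurableT mf.
have fE x : f x = limn (EFin \o g ^~ x).
  by apply/esym/cvg_lim => //; exact: cvg_nnsfun_approx.
transitivity (limn (fun n => \int[nu]_x (g n x)%:E)).
  rewrite -monotone_convergence//=.
  - by apply: eq_integral => x _; rewrite fE.
  - by move=> n; exact/measurable_EFinP.
  - by move=> n x _; rewrite lee_fin.
  - by move=> x _ a b ab; rewrite lee_fin; exact/lefP/nd_nnsfun_approx.
transitivity (limn (fun n => \int[m]_x ((g n x)%:E * (h x)%:E))).
  by apply/congr_lim/funext => n; exact: integral_density_nnsfun.
rewrite -monotone_convergence//=.
- apply: eq_integral => x _; rewrite fE muleC.
  under [in LHS]eq_fun do rewrite muleC.
  apply/cvg_lim => //; rewrite -fE.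
  by apply: cvgeZl => //; exact: cvg_nnsfun_approx.
- by move=> n; apply: emeasurable_funM; exact/measurable_EFinP.
- by move=> n x _; rewrite mule_ge0// lee_fin.
- move=> x _ a b ab; rewrite lee_wpmul2r ?lee_fin//; exact/lefP/nd_nnsfun_approx.
Qed.
End density.

Section independence.
Local Open Scope ereal_scope.
Context d1 d2 (T : measurableType d1) (T2 : measurableType d2) (R : realType).
Variables (P : probability T R) (Z : T -> T2) (G : set (set T)).
Hypothesis mZ : measurable_fun setT Z.
Hypothesis GI : setI_closed G.
Hypothesis GT : G setT.
Hypothesis Gm : G `<=` measurable.
Hypothesis indep : forall A B, G A -> measurable B ->
  P (A `&` Z @^-1` B) = P A * P (Z @^-1` B).

Let TG := g_sigma_algebraType G.

Let sGm : <<s G >> `<=` @measurable _ T.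
Proof. by apply: smallest_sub => //; exact: sigma_algebra_measurable. Qed.

Let mZB B : measurable B -> measurable (Z @^-1` B).
Proof. by move=> mB; rewrite -[X in measurable X]setTI; exact: mZ. Qed.

(** For fixed B, both sides are finite measures in A that agree on the pi-system G, which contains
    the whole space; hence they agree on the sigma-algebra generated by G. *)
Let indep_sigma A B : <<s G >> A -> measurable B ->
  P (A `&` Z @^-1` B) = P A * P (Z @^-1` B).
Proof.
move=> sA mB; have mD := mZB mB.
have r0 : (0 <= fine (P (Z @^-1` B)))%R by rewrite fine_ge0.
pose m2 := mscale (NngNum r0) P.
have := @g_sigma_algebra_measure_unique _ _ _ G Gm (fun _ => setT) (fun _ => GT) _
  (mrestr P mD) m2 GI _ _ A sA.
have m2E C : m2 C = P C * P (Z @^-1` B).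
  by rewrite /m2 /mscale/= fineK ?fin_num_measure// muleC.
move=> h; rewrite -m2E; apply: h.
- by rewrite bigcup_const.
- move=> C GC; transitivity (P C * P (Z @^-1` B)); last exact/esym/m2E.
  exact: indep.
- move=> _; apply: (@le_lt_trans _ _ 1); last by rewrite ltry.
  by apply: probability_le1; exact: measurableI.
Qed.

Let toG (w : T) : TG := w.

Let mtoG : measurable_fun setT toG.
Proof. by move=> _ A mA; rewrite setTI; exact: sGm. Qed.

Let toG_mfun : {mfun T >-> TG} := HB.pack toG (isMeasurableFun.Build _ _ _ _ _ mtoG).
Let Z_mfun : {mfun T >-> T2} := HB.pack Z (isMeasurableFun.Build _ _ _ _ _ mZ).
Let toGZ (w : T) : TG * T2 := (toG w, Z w).
Let mtoGZ : measurable_fun setT toGZ.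
Proof. exact: measurable_fun_pair. Qed.
Let toGZ_mfun : {mfun T >-> (TG * T2)%type} :=
  HB.pack toGZ (isMeasurableFun.Build _ _ _ _ _ mtoGZ).

(** Conditioning on the past without conditional expectations. Measurability of [Phi] in its first
    argument for [TG] says that it sees w only through the past; the law of (w, Z w) on TG x T2 is
    then a product, and Tonelli applies. *)
Lemma ge0_integral_indep (Phi : TG * T2 -> \bar R) : measurable_fun setT Phi ->
  (forall x, 0 <= Phi x) ->
  \int[P]_w Phi (w, Z w) = \int[P]_w \int[P]_w' Phi (w, Z w').
Proof.
move=> mPhi Phi0.
have -> : \int[P]_w Phi (w, Z w) = \int[distribution P toGZ_mfun]_x Phi x.
  by rewrite ge0_integral_distribution.
have -> : \int[distribution P toGZ_mfun]_x Phi x =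
    \int[distribution P toG_mfun \x distribution P Z_mfun]_x Phi x.
  apply: eq_measure_integral => A mA _; apply/esym/product_measure_unique => //.
rewrite fubini_tonelli1// ge0_integral_distribution//.
- apply: eq_integral => w _; rewrite /= /fubini_F ge0_integral_distribution//.
  exact: (measurableT_comp mPhi (pair1_measurable _)).
- exact: measurable_fun_fubini_tonelli_F.
- by move=> w; apply: integral_ge0.
Qed.
End independence.

(** * Parseval identity and integrated squared error *)

Section parseval.
Variable R : realType.
Local Notation leb1 := (@lebesgue_measure R).
Local Notation I01 := (`[0%R, 1%R]%classic : set (measurableTypeR R)).

Lemma leb1_I01 : leb1 I01 = 1%E.
Proof. by rewrite lebesgue_measure_itv/= lte_fin ltr01 -EFinB subr0. Qed.

Lemma integrable_I01 (F : R -> R) (C : R) : measurable_fun setT F ->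
  (forall u, 0 <= u <= 1 -> `|F u| <= C) -> leb1.-integrable I01 (EFin \o F).
Proof.
move=> mF FC; apply: measurable_bounded_integrable => //.
- exact: (eq_ind_r (fun x => (x < +oo)%E) (ltry 1) leb1_I01).
- exact: measurable_funTS.
- exists C; split; first exact: num_real.
  move=> c Cc u /=; rewrite in_itv/= => u01.
  exact: le_trans (FC u u01) (ltW Cc).
Qed.

(** The cross term vanishes because F is centered. The constant c carries the contribution of the
    coordinates already integrated out in the induction of [cube_int_sqr]. *)
Lemma integral_I01_sqrD (F : R -> R) (C S a c : R) : measurable_fun setT F ->
  (forall u, 0 <= u <= 1 -> `|F u| <= C) ->
  (\int[leb1]_(u in I01) (F u)%:E = 0)%E ->
  (\int[leb1]_(u in I01) (F u ^+ 2)%:E = S%:E)%E ->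
  (\int[leb1]_(u in I01) ((a + F u) ^+ 2 + c)%:E = (a ^+ 2 + (S + c))%:E)%E.
Proof.
move=> mF FC F0 FS.
have iF : leb1.-integrable I01 (EFin \o F) by exact: integrable_I01 FC.
have iF2 : leb1.-integrable I01 (EFin \o (fun u => F u ^+ 2)).
  apply: (@integrable_I01 _ (C ^+ 2)); first exact: measurable_funX.
  by move=> u u01; rewrite normrX lerXn2r ?nnegrE ?(le_trans _ (FC u u01))// FC.
have icst k : leb1.-integrable I01 (EFin \o cst k).
  exact: (@integrable_I01 _ `|k|).
have iaF : leb1.-integrable I01 (fun u => ((2 * a) * F u)%:E).
  apply: (@integrable_I01 (fun u => 2 * a * F u) (`|2 * a| * C)); first exact: measurable_funM.
  by move=> u u01; rewrite normrM ler_wpM2l// FC.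
rewrite (eq_integral (fun u : measurableTypeR R => ((a ^+ 2 + c)%:E +
    (((2 * a) * F u)%:E + (F u ^+ 2)%:E))%E)); last first.
  by move=> u _; rewrite -!EFinD; congr (_%:E); ring.
rewrite integralD//; [|exact: icst|exact: integrableD].
have -> : (\int[leb1]_(_ in I01) (a ^+ 2 + c)%:E = (a ^+ 2 + c)%:E)%E.
  rewrite integral_cst// -[RHS]mule1.
  exact: (congr1 (fun z => (a ^+ 2 + c)%:E * z)%E leb1_I01).
rewrite integralD// FS.
under eq_integral do rewrite EFinM; rewrite integralZl// F0 mule0 add0e -EFinD.
by congr (_%:E); ring.
Qed.

Lemma cube_int_sqr n (F : 'I_n -> R -> R) (C S : 'I_n -> R) (a : R) :
  (forall k, measurable_fun setT (F k)) ->
  (forall k u, 0 <= u <= 1 -> `|F k u| <= C k) ->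
  (forall k, \int[leb1]_(u in I01) (F k u)%:E = 0)%E ->
  (forall k, \int[leb1]_(u in I01) (F k u ^+ 2)%:E = (S k)%:E)%E ->
  cube_int (fun x : n.-tuple R => ((a + \sum_k F k (tnth x k)) ^+ 2)%:E) =
  (a ^+ 2 + \sum_k S k)%:E.
Proof.
elim: n F C S a => [|n ih] F C S a mF FC F0 FS /=; first by rewrite !big_ord0 !addr0.
rewrite big_ord_recl -(@integral_I01_sqrD (F ord0) (C ord0) (S ord0))//; last exact: FC.
apply: eq_integral => u _.
rewrite -(ih (fun k => F (lift ord0 k)) (fun k => C (lift ord0 k))
  (fun k => S (lift ord0 k)))//; last first.
  by move=> k v v01; exact: FC.
congr (cube_int _); apply/funext => v; rewrite big_ord_recl tnth0 addrA.
by under eq_bigr do rewrite tnthS.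
Qed.

Variables (p : nat) (psi : 'I_p -> nat -> R -> R) (M : R).
Hypothesis mpsi : forall k j, measurable_fun setT (psi k j).
Hypothesis psiM : forall k j u, 0 <= u <= 1 -> `|psi k j u| <= M.
Hypothesis psi0 : forall k j, (\int[leb1]_(u in I01) (psi k j u)%:E = 0)%E.
Hypothesis psi_orth : forall k i j,
  (\int[leb1]_(u in I01) (psi k i u * psi k j u)%:E = ((i == j)%:R)%:E)%E.

Lemma cube_int_evalp_sqr J (u : param R p) :
  cube_int (fun x => ((evalp psi J u x) ^+ 2)%:E) =
  (psum J (u.1 ^+ 2) (fun k j => u.2 k j ^+ 2))%:E.
Proof.
apply: (@cube_int_sqr p (fun k v => \sum_(j < J) u.2 k j * psi k j v)
  (fun k => \sum_(j < J) `|u.2 k j| * M) (fun k => \sum_(j < J) u.2 k j ^+ 2) u.1).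
- by move=> k; apply: measurable_sum => j; apply: measurable_funM.
- move=> k v v01; rewrite (le_trans (ler_norm_sum _ _ _))// ler_sum// => j _.
  by rewrite normrM ler_wpM2l// psiM.
- move=> k; under eq_integral do rewrite -sumEFin.
  rewrite integral_sum//=; last first.
    move=> j; apply: (@integrable_I01 _ (`|u.2 k j| * M)); first exact: measurable_funM.
    by move=> v v01; rewrite normrM ler_wpM2l// psiM.
  rewrite big1// => j _; under eq_integral do rewrite EFinM.
  by rewrite integralZl// ?psi0 ?mule0//; exact: integrable_I01 (psiM k j).
- move=> k.
  have ipp i j : leb1.-integrable I01 (fun v => (psi k i v * psi k j v)%:E).
    apply: (@integrable_I01 (fun v => psi k i v * psi k j v) (M * M)).
      exact: measurable_funM.
    by move=> v v01; rewrite normrM ler_pM// psiM.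
  rewrite (eq_integral (fun v : measurableTypeR R => (\sum_(i < J) \sum_(j < J)
      (u.2 k i * u.2 k j)%:E * (psi k i v * psi k j v)%:E)%E)); last first.
    move=> v _; rewrite expr2 mulr_suml -sumEFin; apply: eq_bigr => i _.
    rewrite mulr_sumr -sumEFin; apply: eq_bigr => j _; rewrite -EFinM.
    by congr (_%:E); ring.
  rewrite integral_sum//=; last first.
    by move=> i; apply: integrable_sum => // j _; exact: integrableZl.
  rewrite -sumEFin; apply: eq_bigr => i _.
  rewrite integral_sum//=; last by move=> j; exact: integrableZl.
  rewrite (bigD1 i)//= big1 ?adde0; last first.
    move=> j ji; rewrite integralZl// psi_orth.
    have /negbTE -> : i != j :> nat by rewrite eq_sym.
    by rewrite mule0.
  by rewrite integralZl// psi_orth eqxx mule1 -expr2.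
Qed.

End parseval.

Lemma cvg_sumr (R : realType) (I : Type) (r : seq I) (f : I -> nat -> R) (l : I -> R) :
  (forall i, f i @ \oo --> l i) ->
  (\sum_(i <- r) f i n) @[n --> \oo] --> \sum_(i <- r) l i.
Proof.
move=> h; elim: r => [|i r ih].
  by rewrite big_nil; under eq_fun do rewrite big_nil; exact: cvg_cst.
by rewrite big_cons; under eq_fun do rewrite big_cons; exact: cvgD.
Qed.

(** * Risk as squared coefficient distance plus tail *)

Section risk.
Variables (R : realType) (p : nat) (psi : 'I_p -> nat -> R -> R) (M Rad : R).
Local Notation leb1 := (@lebesgue_measure R).
Local Notation I01 := (`[0%R, 1%R]%classic : set (measurableTypeR R)).
Hypothesis M0 : 1 <= M.
Hypothesis Rad0 : 0 < Rad.
Hypothesis mpsi : forall k j, measurable_fun setT (psi k j).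
Hypothesis psiM : forall k j u, 0 <= u <= 1 -> `|psi k j u| <= M.
Hypothesis psi0 : forall k j, (\int[leb1]_(u in I01) (psi k j u)%:E = 0)%E.
Hypothesis psi_orth : forall k i j,
  (\int[leb1]_(u in I01) (psi k i u * psi k j u)%:E = ((i == j)%:R)%:E)%E.
Variables (alpha : R) (theta : 'I_p -> nat -> R).
Hypothesis theta_l1 :
  ((`|alpha|)%:E + \sum_(k < p) \sum_(0 <= j <oo) (`|theta k j|)%:E <= Rad%:E)%E.
Variable q : p.-tuple R -> R.
Hypothesis qE : forall x, in_cube x -> q x =
  alpha + \sum_(k < p) limn (fun n => \sum_(j < n) theta k j * psi k j (tnth x k)).

Local Notation ptheta := ((alpha, theta) : param R p).
Local Notation mu := (@cube_prob R p).
Local Notation D := (@cube R p).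

Lemma evalp_psum J (u : param R p) x :
  evalp psi J u x = psum J u.1 (fun k j => u.2 k j * psi k j (tnth x k)).
Proof. by []. Qed.

Lemma norm_evalp_le J (u : param R p) x : in_cube x -> `|evalp psi J u x| <= M * l1n J u.
Proof.
move=> x01; rewrite l1nE psumZ evalp_psum /psum.
rewrite (le_trans (ler_normD _ _))// lerD//.
  by rewrite ler_peMl.
rewrite (le_trans (ler_norm_sum _ _ _))// ler_sum// => k _.
rewrite (le_trans (ler_norm_sum _ _ _))// ler_sum// => j _.
by rewrite normrM mulrC ler_wpM2r// psiM.
Qed.

Lemma l1n_theta_le n : l1n n ptheta <= Rad.
Proof.
rewrite -lee_fin (le_trans _ theta_l1)// /l1n EFinD leeD2l// -sumEFin lee_sum// => k _.
rewrite -sumEFin.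
rewrite -(big_mkord xpredT (fun j => (`|theta k j|)%:E)).
by apply: nneseries_lim_ge.
Qed.

(** The [limn] of the model is informative only if the series converge; they converge absolutely, by
    the l1 bound on theta and the uniform bound M on the basis. *)
Lemma cvg_evalp_theta x : in_cube x -> evalp psi n ptheta x @[n --> \oo] --> q x.
Proof.
move=> x01; rewrite qE//; apply: cvgD; first exact: cvg_cst.
apply: cvg_sumr => k.
have cvg_norm : cvgn (series (fun j => `|theta k j| * M)).
  apply: nondecreasing_is_cvgn.
    by apply: nondecreasing_series => n _ _; rewrite mulr_ge0// (le_trans ler01).
  exists (Rad * M) => _ [n _ <-] /=; rewrite /series/= -mulr_suml.
  rewrite ler_wpM2r ?(le_trans ler01)// (le_trans _ (l1n_theta_le n))//.
  rewrite /l1n/= (bigD1 k)//= big_mkord.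
  have h2 : 0 <= \sum_(i < p | i != k) \sum_(j < n) `|theta i j|.
    by rewrite sumr_ge0// => i _; rewrite sumr_ge0.
  have := normr_ge0 alpha; lra.
have : cvgn (series (fun j => theta k j * psi k j (tnth x k))).
  apply: normed_cvg; apply: series_le_cvg cvg_norm => n /=.
  - exact: normr_ge0.
  - by rewrite mulr_ge0// (le_trans ler01).
  - by rewrite normrM ler_wpM2l// psiM.
rewrite /series; under eq_fun do rewrite big_mkord.
by [].
Qed.

Lemma norm_q_le x : in_cube x -> `|q x| <= M * Rad.
Proof.
move=> x01.
have h : `|evalp psi n ptheta x| @[n --> \oo] --> `|q x|.
  by apply: cvg_norm; exact: cvg_evalp_theta.
rewrite -(cvg_lim _ h)//; apply: limr_le; first by apply/cvg_ex; eexists; exact: h.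
near=> n; rewrite (le_trans (norm_evalp_le _ _ x01))//.
by rewrite ler_wpM2l ?(le_trans ler01)// l1n_theta_le.
Unshelve. all: by end_near. Qed.

Lemma measurable_evalp_cube J (u : param R p) : measurable_fun D (evalp psi J u).
Proof.
apply: measurable_funTS.
apply: (@measurable_evalp R p _ (p.-tuple R) psi J (fun _ => u) id) => //.
Qed.

(** Measurability is read off the expansion, as a pointwise limit on the cube, rather than off the
    infimum defining the quantile. *)
Lemma measurable_q : measurable_fun D q.
Proof.
apply: (measurable_fun_cvg (h := fun n => evalp psi n ptheta)).
  by move=> n; exact: measurable_evalp_cube.
exact: cvg_evalp_theta.
Qed.

Lemma evalp_supported J n (u : param R p) x : supported J u -> (J <= n)%N ->
  evalp psi n u x = evalp psi J u x.
Proof.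
move=> su Jn; rewrite /evalp; congr (_ + _); apply: eq_bigr => k _.
rewrite -!(big_mkord xpredT (fun j => u.2 k j * psi k j (tnth x k))).
rewrite (big_cat_nat (leq0n J) Jn)/= [X in _ + X]big_nat_cond [X in _ + X]big1 ?addr0//.
by move=> j /andP[/andP[Jj _] _]; rewrite su// mul0r.
Qed.

Lemma evalp_sub J (u v : param R p) x :
  evalp psi J u x - evalp psi J v x = evalp psi J (psub u v) x.
Proof.
rewrite -mulN1r !evalp_psum psumZ psumD; apply: eq_psum => [|k j _] /=; ring.
Qed.

Definition risk J (u : param R p) : R := \int[mu]_(x in D) (evalp psi J u x - q x) ^+ 2.

Lemma cube_int_sqr_sub (f g : p.-tuple R -> R) : measurable_fun D f -> measurable_fun D g ->
  cube_int (fun x => ((f x - g x) ^+ 2)%:E) =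
  (\int[mu]_(x in D) ((f x - g x) ^+ 2)%:E)%E.
Proof.
move=> mf mg; apply: cube_intE => [|x _]; last by rewrite lee_fin sqr_ge0.
by apply/measurable_EFinP; apply: measurable_funX; exact: measurable_funB.
Qed.

Lemma sqr_sub_le (a b : R) : `|a| <= M * Rad -> `|b| <= M * Rad ->
  (a - b) ^+ 2 <= (2 * (M * Rad)) ^+ 2.
Proof.
move=> aM bM; rewrite -real_normK ?num_real// lerXn2r ?nnegrE//.
  by rewrite mulr_ge0// mulr_ge0// ?(ltW Rad0)// (le_trans ler01).
rewrite (le_trans (ler_normB _ _))//; lra.
Qed.

Lemma integrable_cube (f : p.-tuple R -> R) (C : R) : measurable_fun D f ->
  (forall x, in_cube x -> `|f x| <= C) -> mu.-integrable D (EFin \o f).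
Proof.
move=> mf fC; apply: measurable_bounded_integrable => //.
- exact: measurable_cube.
- exact: (eq_ind_r (fun z => (z < +oo)%E) (ltry 1) (cube_prob_cube R p)).
- exists C; split; first exact: num_real.
  move=> c Cc u /= u01; exact: le_trans (fC u u01) (ltW Cc).
Qed.

Lemma risk_integrable J (u : param R p) : l1n J u <= Rad ->
  mu.-integrable D (EFin \o (fun x => (evalp psi J u x - q x) ^+ 2)).
Proof.
move=> uR; apply: (@integrable_cube _ ((2 * (M * Rad)) ^+ 2)).
  by apply: measurable_funX; apply: measurable_funB;
    [exact: measurable_evalp_cube|exact: measurable_q].
move=> x x01; rewrite ger0_norm ?sqr_ge0// sqr_sub_le ?norm_q_le//.
by rewrite (le_trans (norm_evalp_le _ _ x01))// ler_wpM2l// (le_trans ler01).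
Qed.

Lemma cube_int_risk J (u : param R p) : l1n J u <= Rad ->
  cube_int (fun x => ((evalp psi J u x - q x) ^+ 2)%:E) = (risk J u)%:E.
Proof.
move=> uR; rewrite cube_int_sqr_sub; [|exact: measurable_evalp_cube|exact: measurable_q].
by rewrite /risk /Rintegral fineK//; apply: integrable_fin_num;
  [exact: measurable_cube|exact: risk_integrable].
Qed.

Lemma risk_ge0 J u : 0 <= risk J u.
Proof. by apply: Rintegral_ge0 => x _; exact: sqr_ge0. Qed.

Lemma risk_le J u : l1n J u <= Rad -> risk J u <= (2 * (M * Rad)) ^+ 2.
Proof.
move=> uR; rewrite -[leRHS]mulr1 -[X in _ * X](_ : fine (mu D) = 1); last first.
  by rewrite cube_prob_cube.
rewrite -Rintegral_cst; last exact: measurable_cube.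
apply: le_Rintegral => //; first exact: measurable_cube.
- exact: risk_integrable.
- exact: (@integrable_cube _ `|(2 * (M * Rad)) ^+ 2|).
- move=> x x01; rewrite sqr_sub_le ?norm_q_le//.
  by rewrite (le_trans (norm_evalp_le _ _ x01))// ler_wpM2l// (le_trans ler01).
Qed.

(** Finite Parseval evaluates the squared distance from u to each partial sum of q; dominated
    convergence, with the constant (2 M Rad)^2, then passes to q itself. *)
Lemma risk_cvg J (u : param R p) : supported J u -> l1n J u <= Rad ->
  dist2 n u ptheta @[n --> \oo] --> risk J u.
Proof.
move=> su uR.
pose f n x := ((evalp psi J u x - evalp psi n ptheta x) ^+ 2)%:E.
have mf n : measurable_fun D (f n).
  apply/measurable_EFinP; apply: measurable_funX; apply: measurable_funB;
    exact: measurable_evalp_cube.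
have uM x : in_cube x -> `|evalp psi J u x| <= M * Rad.
  by move=> x01; rewrite (le_trans (norm_evalp_le _ _ x01))// ler_wpM2l// (le_trans ler01).
have f_f x : D x -> f ^~ x @ \oo --> ((evalp psi J u x - q x) ^+ 2)%:E.
  move=> x01; apply: cvg_EFin; first by near=> n.
  apply: (@cvg_comp _ _ _ (fun n => evalp psi J u x - evalp psi n ptheta x)
    (fun y : R => y ^+ 2) _ (nbhs (evalp psi J u x - q x))); last exact: exprn_continuous.
  apply: cvgB; [exact: cvg_cst|exact: cvg_evalp_theta].
have ig : mu.-integrable D (fun _ => ((2 * (M * Rad)) ^+ 2)%:E).
  exact: (@integrable_cube (cst ((2 * (M * Rad)) ^+ 2)) `|(2 * (M * Rad)) ^+ 2|).
have f_g x n : D x -> (`|f n x| <= ((2 * (M * Rad)) ^+ 2)%:E)%E.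
  move=> x01; rewrite lee_fin ger0_norm ?sqr_ge0// sqr_sub_le ?uM//.
  rewrite (le_trans (norm_evalp_le _ _ x01))// ler_wpM2l// ?(le_trans ler01)//.
  exact: l1n_theta_le.
have mq := measurable_int mu (risk_integrable uR).
have [_ _ h] := dominated_convergence (@measurable_cube R p) mf mq
  (aeW mu f_f) ig (aeW mu f_g).
have {}h : (dist2 n u ptheta)%:E @[n --> \oo] --> (risk J u)%:E.
  rewrite -cube_int_risk// cube_int_sqr_sub; [|exact: measurable_evalp_cube|exact: measurable_q].
  apply: cvg_trans h; apply: near_eq_cvg; near=> n.
  rewrite /f /= -cube_int_sqr_sub; [|exact: measurable_evalp_cube..].
  have Jn : (J <= n)%N by near: n; exact: nbhs_infty_ge.
  rewrite (_ : (fun x => _) = fun x => ((evalp psi n (psub u ptheta) x) ^+ 2)%:E).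
    by rewrite (cube_int_evalp_sqr mpsi psiM psi0 psi_orth).
  by apply/funext => x; rewrite -evalp_sub (evalp_supported _ su Jn).
by move/fine_cvgP : h => [].
Unshelve. all: end_near.
Qed.

Definition tail2 J n : R := \sum_(k < p) \sum_(J <= j < n) theta k j ^+ 2.

Lemma dist2_tail J n (u : param R p) : supported J u -> (J <= n)%N ->
  dist2 n u ptheta = dist2 J u ptheta + tail2 J n.
Proof.
move=> su Jn; rewrite /dist2 -addrA; congr (_ + _); rewrite /tail2 -big_split/=.
apply: eq_bigr => k _; rewrite -!(big_mkord xpredT (fun j => (u.2 k j - theta k j) ^+ 2)).
rewrite (big_cat_nat (leq0n J) Jn)/=; congr (_ + _); rewrite big_nat_cond [RHS]big_nat_cond.
by apply: eq_bigr => j /andP[/andP[Jj _] _]; rewrite su// sub0r sqrrN.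
Qed.

Definition trunc J : param R p := (alpha, fun k j => if (j < J)%N then theta k j else 0).

Lemma supported_trunc J : supported J (trunc J).
Proof. by move=> k j Jj; rewrite /= ltnNge Jj. Qed.

Lemma l1n_trunc J : l1n J (trunc J) <= Rad.
Proof.
rewrite (le_trans _ (l1n_theta_le J))// !l1nE; apply: ler_psum => //= k j jJ.
by rewrite jJ.
Qed.

Lemma evalp_trunc J x : evalp psi J (trunc J) x = evalp psi J ptheta x.
Proof. by rewrite !evalp_psum; apply: eq_psum => //= k j ->. Qed.

Lemma dist2_trunc J u : dist2 J u (trunc J) = dist2 J u ptheta.
Proof. by rewrite !dist2E; apply: eq_psum => //= k j ->. Qed.

(** The squared norm of theta* beyond J, written as the risk of the truncation: nonnegativity and
    the integral form needed in the one-step bound are then immediate, and [tail_cvg] recovers the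
    series. *)
Definition tail J := risk J (trunc J).

Lemma tail_cvg J : tail2 J n @[n --> \oo] --> tail J.
Proof.
apply: cvg_trans (risk_cvg (supported_trunc (J := J)) (l1n_trunc J)).
apply: near_eq_cvg; near=> n.
have Jn : (J <= n)%N by near: n; exact: nbhs_infty_ge.
rewrite (dist2_tail (supported_trunc (J := J)) Jn).
rewrite (_ : dist2 J _ _ = 0) ?add0r//.
rewrite -dist2_trunc dist2E /psum !subrr expr0n/= add0r big1// => k _.
by rewrite big1// => j _; rewrite subrr expr0n.
Unshelve. all: end_near.
Qed.

Lemma riskE J (u : param R p) : supported J u -> l1n J u <= Rad ->
  risk J u = dist2 J u ptheta + tail J.
Proof.
move=> su uR; apply: (cvg_unique _ (risk_cvg su uR)) => //.
have h : dist2 J u ptheta + tail2 J n @[n --> \oo] --> dist2 J u ptheta + tail J.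
  by apply: cvgD; [exact: cvg_cst|exact: tail_cvg].
apply: cvg_trans h; apply: near_eq_cvg; near=> n.
have Jn : (J <= n)%N by near: n; exact: nbhs_infty_ge.
by rewrite (dist2_tail su Jn).
Unshelve. all: end_near.
Qed.

Lemma risk_widen J n (u : param R p) : supported J u -> (J <= n)%N ->
  risk n u = risk J u.
Proof.
by move=> su Jn; apply: eq_Rintegral => x _; rewrite (evalp_supported _ su Jn).
Qed.

(** Kept in multiplied form so that J = 0 needs no separate treatment. *)
Lemma tail_le s Q J : 0 <= s ->
  (forall k, (\sum_(0 <= j <oo) ((j.+1%:R `^ (2 * s)) * theta k j ^+ 2)%:E
              < (Q ^+ 2)%:E)%E) ->
  tail J * (J%:R `^ (2 * s)) <= p%:R * Q ^+ 2.
Proof.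
move=> s0 hQ.
have h : tail2 J n * (J%:R `^ (2 * s)) @[n --> \oo] --> tail J * (J%:R `^ (2 * s)).
  by apply: cvgM; [exact: tail_cvg|exact: cvg_cst].
rewrite -(cvg_lim _ h)//; apply: limr_le; first by apply/cvg_ex; eexists; exact: h.
near=> n; rewrite /tail2 mulr_suml (_ : p%:R * _ = \sum_(k < p) Q ^+ 2); last first.
  by rewrite sumr_const card_ord mulr_natl.
apply: ler_sum => k _; rewrite -lee_fin; apply: le_trans (ltW (hQ k)).
have Jn : (J <= n)%N by near: n; exact: nbhs_infty_ge.
apply: le_trans (nneseries_lim_ge n _); last first.
  by move=> i _ _; rewrite lee_fin mulr_ge0 ?powR_ge0 ?sqr_ge0.
rewrite sumEFin lee_fin (big_cat_nat (leq0n J) Jn)/=.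
rewrite -[leLHS]add0r lerD//.
  by rewrite sumr_ge0// => j _; rewrite mulr_ge0 ?powR_ge0 ?sqr_ge0.
(* Storage is 0-based: entry j has Sobolev weight (j + 1)^(2s), which dominates J^(2s) once j >=
   J. *)
rewrite mulr_suml; apply: ler_sum_nat => j /andP[Jj _].
rewrite mulrC ler_wpM2r ?sqr_ge0//.
by apply: ge0_ler_powR; rewrite ?nnegrE ?mulr_ge0// ler_nat ltnW.
Unshelve. all: end_near.
Qed.

End risk.

(** * One step of the algorithm *)

Section law.
Variables (R : realType) (p : nat) (pX : p.-tuple R -> R) (pYX : p.-tuple R -> R -> R).
Variables (d : measure_display) (T : measurableType d) (P : probability T R).
Variables (X : T -> p.-tuple R) (Y : T -> R).
Hypothesis mpX : measurable_fun setT pX.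
Hypothesis pX0 : forall x, in_cube x -> 0 <= pX x.
Hypothesis mpYX : measurable_fun setT (fun z : p.-tuple R * R => pYX z.1 z.2).
Hypothesis pYX0 : forall x y, in_cube x -> 0 <= pYX x y.
Hypothesis mX : measurable_fun setT X.
Hypothesis mY : measurable_fun setT Y.
Hypothesis lawE : forall B : set (p.-tuple R * R), measurable B ->
  P ((fun w => (X w, Y w)) @^-1` B) =
  cube_int (fun x => (pX x)%:E *
    \int[@lebesgue_measure R]_y ((\1_B (x, y))%:E * (pYX x y)%:E))%E.

Local Notation mu := (@cube_prob R p).
Local Notation D := (@cube R p).

(** Extended by zero off the cube, where the sign of [pX] and [pYX] is unconstrained; this makes it
    nonnegative everywhere. *)
Let dens : p.-tuple R * R -> R :=
  (fun z => pX z.1 * pYX z.1 z.2) \_ (D `*` setT).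

Let mdens : measurable_fun setT dens.
Proof.
apply/(measurable_restrictT _ _).1.
  by apply: measurableX => //; exact: measurable_cube.
apply: measurable_funTS; apply: measurable_funM => //.
exact: (measurableT_comp mpX measurable_fst).
Qed.

Let densE x y : in_cube x -> dens (x, y) = pX x * pYX x y.
Proof. by move=> x01; rewrite /dens patchE mem_set. Qed.

Let dens_out x y : ~ in_cube x -> dens (x, y) = 0.
Proof. by move=> x01; rewrite /dens patchE memNset//= => -[]. Qed.

Let dens_ge0 z : 0 <= dens z.
Proof.
case: z => x y; have [x01|x01] := pselect (in_cube x); last by rewrite dens_out.
by rewrite densE// mulr_ge0// ?pX0// pYX0.
Qed.

Let Z w := (X w, Y w).
Let mZ : measurable_fun setT Z.
Proof. exact: measurable_fun_pair. Qed.
Let Z_mfun : {mfun T >-> (p.-tuple R * R)%type} :=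
  HB.pack Z (isMeasurableFun.Build _ _ _ _ _ mZ).

Let mpYX_section x : measurable_fun setT (pYX x).
Proof. exact: (measurableT_comp mpYX (pair1_measurable x)). Qed.

Let lawdE B : measurable B -> distribution P Z_mfun B =
  (\int[mu \x @leb R]_z ((\1_B z)%:E * (dens z)%:E))%E.
Proof.
move=> mB; rewrite [LHS](lawE mB).
have mBd : measurable_fun setT (fun z => (\1_B z)%:E * (dens z)%:E)%E.
  by apply: emeasurable_funM; apply/measurable_EFinP => //; exact: measurable_indic.
rewrite fubini_tonelli1//; last by move=> z; rewrite mule_ge0// lee_fin.
rewrite -cube_int_setT; last 2 first.
- apply: measurable_fun_fubini_tonelli_F => //.
  by move=> z; rewrite mule_ge0// lee_fin.
- by move=> x; apply: integral_ge0 => y _; rewrite mule_ge0// lee_fin.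
apply: eq_cube_int => x x01; rewrite /fubini_F.
have mx : measurable_fun setT (fun y => (\1_B (x, y))%:E * (pYX x y)%:E)%E.
  apply: emeasurable_funM; apply/measurable_EFinP; last exact: mpYX_section.
  have mB1 : measurable_fun setT (\1_B : _ -> R) by exact: measurable_indic.
  exact: (measurableT_comp mB1 (pair1_measurable x)).
rewrite -integral_leb//; last by move=> y _; rewrite mule_ge0// lee_fin ?pYX0.
rewrite -ge0_integralZl//; last 2 first.
- by move=> y _; rewrite mule_ge0// lee_fin ?pYX0.
- by rewrite lee_fin pX0.
by apply: eq_integral => y _; rewrite densE// EFinM muleCA.
Qed.

Lemma integral_law (phi : p.-tuple R * R -> R) : measurable_fun setT phi ->
  (forall z, 0 <= phi z) ->
  (\int[P]_w (phi (X w, Y w))%:E =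
   \int[mu]_(x in D) \int[@lebesgue_measure R]_y (phi (x, y) * (pX x * pYX x y))%:E)%E.
Proof.
move=> mphi phi0.
have -> : (\int[P]_w (phi (X w, Y w))%:E = \int[distribution P Z_mfun]_z (phi z)%:E)%E.
  by rewrite ge0_integral_distribution//; exact/measurable_EFinP.
rewrite (ge0_integral_density mdens dens_ge0 lawdE);
  [|exact/measurable_EFinP|by move=> z; rewrite lee_fin].
rewrite fubini_tonelli1; last 2 first.
- by apply: emeasurable_funM; exact/measurable_EFinP.
- by move=> z; rewrite mule_ge0 ?lee_fin.
rewrite [RHS]integral_mkcond; apply: eq_integral => x _; rewrite patchE.
case: ifPn => [/set_mem x01|]; last first.
  rewrite notin_setE => x01.
  by rewrite /fubini_F integral0_eq// => y _; rewrite dens_out// mule0.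
rewrite /fubini_F -integral_leb//.
- by apply: eq_integral => y _; rewrite densE// -EFinM.
- apply/measurable_EFinP; apply: measurable_funM.
    exact: (measurableT_comp mphi (pair1_measurable x)).
  by apply: measurable_funM => //; exact: mpYX_section.
- by move=> y _; rewrite lee_fin !mulr_ge0// ?pX0// pYX0.
Qed.

Lemma measurable_integral_law (phi : p.-tuple R * R -> R) : measurable_fun setT phi ->
  (forall z, 0 <= phi z) ->
  measurable_fun D (fun x =>
   \int[@lebesgue_measure R]_y (phi (x, y) * (pX x * pYX x y))%:E)%E.
Proof.
move=> mphi phi0.
have h := @measurable_fun_fubini_tonelli_F _ _ _ _ R (@leb R)
  (fun z : p.-tuple R * R => ((phi z)%:E * (dens z)%:E)%E).
apply: (eq_measurable_fun (fubini_F (@leb R)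
  (fun z : p.-tuple R * R => ((phi z)%:E * (dens z)%:E)%E))).
  move=> x /set_mem x01; rewrite /fubini_F -integral_leb//.
  - by apply: eq_integral => y _; rewrite densE// -EFinM.
  - apply/measurable_EFinP; apply: measurable_funM.
      exact: (measurableT_comp mphi (pair1_measurable x)).
    by apply: measurable_funM => //; exact: mpYX_section.
  - by move=> y _; rewrite lee_fin !mulr_ge0// ?pX0// pYX0.
apply: measurable_funTS; apply: h.
- by apply: emeasurable_funM; exact/measurable_EFinP.
- by move=> z; rewrite mule_ge0 ?lee_fin.
Qed.

End law.

Section step_arithmetic.
Variable R : realType.

(* AM-GM absorbs the truncation error [w - q] into half of the curvature term. *)
Lemma quantile_gap_le (tau F v q w c1 c2 : R) : 0 < c1 ->
  (tau - F) * (v - q) <= - (c1 * (v - q) ^+ 2) -> `|tau - F| <= c2 * `|v - q| ->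
  2 * ((tau - F) * (v - w)) <= - c1 * (v - q) ^+ 2 + c2 ^+ 2 / c1 * (w - q) ^+ 2.
Proof.
move=> c10 h1 h2.
have h3 : (tau - F) * (q - w) <= c2 * `|v - q| * `|w - q|.
  by rewrite (le_trans (ler_norm _))// normrM -[`|q - w|]distrC ler_wpM2r.
have h4 : c2 * `|v - q| * `|w - q| = c1 * (`|v - q| * (c2 / c1 * `|w - q|)).
  by field; exact: lt0r_neq0.
have h5 : (v - q) ^+ 2 = `|v - q| ^+ 2 by rewrite real_normK ?num_real.
have h6 : c2 ^+ 2 / c1 * (w - q) ^+ 2 = c1 * (c2 / c1 * `|w - q|) ^+ 2.
  by rewrite exprMn real_normK ?num_real//; field; exact: lt0r_neq0.
have -> : (tau - F) * (v - w) = (tau - F) * (v - q) + (tau - F) * (q - w) by ring.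
rewrite h6; rewrite h4 in h3; rewrite h5 in h1 *.
move: h1 h3; move: (`|v - q|) (c2 / c1 * `|w - q|) ((tau - F) * (v - q)) ((tau - F) * (q - w)).
move=> a b x y; clear -c10 => h1 h3.
have h7 : 0 <= c1 * (a - b) ^+ 2 by rewrite mulr_ge0 ?sqr_ge0// ltW.
rewrite (_ : c1 * (a - b) ^+ 2 =
  c1 * a ^+ 2 + c1 * b ^+ 2 - 2 * (c1 * (a * b))) in h7; last by ring.
lra.
Qed.

(** r1 and r0 are the risks after Y <= v and Y > v, weighted by F and 1 - F; the gradient factors
    average to (tau - 1) F + tau (1 - F) = tau - F. *)
Lemma mixture_le (r0 r1 F G gam tau dl K c1 c x y : R) : 0 <= F <= 1 -> 0 <= gam ->
  r1 <= G + 2 * gam * (tau - 1) * dl + K -> r0 <= G + 2 * gam * (tau - 0) * dl + K ->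
  2 * ((tau - F) * dl) <= - c1 * x + c * y ->
  r1 * F + r0 * (1 - F) <= G + K - gam * c1 * x + gam * c * y.
Proof.
move=> /andP[F0 F1] gam0 e1 e0 /(ler_wpM2l gam0) key.
have e1' := ler_wpM2r F0 e1.
have F10 : 0 <= 1 - F by rewrite subr_ge0.
have e0' := ler_wpM2r F10 e0.
apply: le_trans (lerD e1' e0') _.
rewrite [leLHS](_ : _ = G + K + gam * (2 * ((tau - F) * dl))); last by ring.
by rewrite -[leRHS]addrA lerD2l (le_trans key)// le_eqVlt; apply/orP; left; apply/eqP; ring.
Qed.

(** Here c is the density of X at a point. It is replaced by its lower bound in the negative
    curvature term and by its upper bound in the truncation term, and kept in front of K, where it
    will integrate to 1. *)
Lemma weighted_step_le (K ga gb c C1 C2 a b : R) : ga * a * C1 <= ga * a * c ->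
  gb * b * c <= gb * b * C2 ->
  c * (K - ga * a + gb * b) <= K * c + (- (ga * C1) * a + gb * C2 * b).
Proof. by move=> h1 h2; lra. Qed.

End step_arithmetic.

(** * Expected decrease of the risk in one step *)

Section one_step.
Variables (R : realType) (p : nat) (tau s A Rad M C1 C2 c1 c2 : R).
Hypothesis tau01 : 0 < tau < 1.
Hypothesis A0 : 0 <= A.
Hypothesis Rad0 : 0 < Rad.
Hypothesis M1 : 1 <= M.
Hypothesis C10 : 0 < C1.
Hypothesis c10 : 0 < c1.
Variables (psi : 'I_p -> nat -> R -> R) (alpha : R) (theta : 'I_p -> nat -> R).
Local Notation leb1 := (@lebesgue_measure R).
Local Notation I01 := (`[0%R, 1%R]%classic : set (measurableTypeR R)).
Hypothesis mpsi : forall k j, measurable_fun setT (psi k j).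
Hypothesis psiM : forall k j u, 0 <= u <= 1 -> `|psi k j u| <= M.
Hypothesis psi0 : forall k j, (\int[leb1]_(u in I01) (psi k j u)%:E = 0)%E.
Hypothesis psi_orth : forall k i j,
  (\int[leb1]_(u in I01) (psi k i u * psi k j u)%:E = ((i == j)%:R)%:E)%E.
Hypothesis theta_l1 :
  ((`|alpha|)%:E + \sum_(k < p) \sum_(0 <= j <oo) (`|theta k j|)%:E <= Rad%:E)%E.
Variables (pX : p.-tuple R -> R) (pYX : p.-tuple R -> R -> R).
Hypothesis mpX : measurable_fun setT pX.
Hypothesis pXC : forall x, in_cube x -> C1 <= pX x <= C2.
Hypothesis mpYX : measurable_fun setT (fun z : p.-tuple R * R => pYX z.1 z.2).
Hypothesis pYX0 : forall x y, in_cube x -> 0 <= pYX x y.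
Hypothesis pYX1 : forall x, in_cube x -> (\int[leb1]_y (pYX x y)%:E = 1)%E.
Hypothesis pYXc : forall x y, in_cube x -> - (M * Rad) <= y <= M * Rad ->
  c1 <= pYX x y <= c2.
Hypothesis model : forall x, in_cube x -> cond_quantile tau pYX x =
  alpha + \sum_(k < p) limn (fun n => \sum_(j < n) theta k j * psi k j (tnth x k)).

Local Notation q := (cond_quantile tau pYX).
Local Notation ptheta := ((alpha, theta) : param R p).
Local Notation mu := (@cube_prob R p).
Local Notation D := (@cube R p).
Local Notation prisk := (risk psi q).
Local Notation ptail := (tail psi alpha theta q).
Local Notation riskE' := (riskE M1 Rad0 mpsi psiM psi0 psi_orth theta_l1 model).

Section step.
Variable t : nat.
Let J := Jt s t.
Let gam := A / t%:R.
Let step := pfgd_step tau s A Rad psi t.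

Let gam0 : 0 <= gam.
Proof. by rewrite /gam divr_ge0. Qed.

Lemma supported_step u x y : supported J (step u x y).
Proof. exact: supported_l1proj. Qed.

Lemma l1n_step u x y : l1n J (step u x y) <= Rad.
Proof. exact: l1n_l1proj. Qed.

Lemma risk_step_le u x y g : supported J u -> l1n J u <= Rad -> in_cube x ->
  g = tau - ((y <= evalp psi J u x)%R)%:R ->
  prisk J (step u x y) <=
    prisk J u + 2 * gam * g * (evalp psi J u x - evalp psi J ptheta x) +
    gam ^+ 2 * ((1 + (p * J)%:R) * M ^+ 2).
Proof.
move=> su uR x01 gE.
rewrite (riskE' (@supported_step u x y) (l1n_step u x y)) (riskE' su uR).
suff h : dist2 J (step u x y) ptheta <= dist2 J u ptheta +
    2 * gam * g * (evalp psi J u x - evalp psi J ptheta x) +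
    gam ^+ 2 * ((1 + (p * J)%:R) * M ^+ 2).
  by move: h; set a := dist2 _ _ _; set b := dist2 _ _ _; lra.
rewrite -dist2_trunc (le_trans (dist2_l1proj _ Rad0 (l1n_trunc theta_l1 J)))//.
rewrite dist2_trunc -/J -/gam -gE.
have g1 : g ^+ 2 <= 1.
  have [ga gb] : -1 <= g /\ g <= 1.
    by rewrite gE; move: tau01 => /andP[t0 t1]; case: (y <= _); rewrite /=; split; lra.
  by rewrite -subr_ge0 (_ : 1 - g ^+ 2 = (1 - g) * (1 + g)) ?mulr_ge0//; [lra..|ring].
apply: (@le_trans _ _ (dist2 J u ptheta +
    (2 * gam * g) * (evalp psi J u x - evalp psi J ptheta x) +
    (gam * g) ^+ 2 * psum J 1 (fun k j => psi k j (tnth x k) ^+ 2))).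
  (* Expanding the square is exact: each coordinate moves by gam * g times its feature, so the cross
     terms assemble into the difference of the two evaluations at x. *)
  rewrite le_eqVlt; apply/orP; left; apply/eqP.
  rewrite evalp_sub evalp_psum !dist2E !psumZ !psumD.
  by apply: eq_psum => [|k j jJ] /=; rewrite ?jJ; ring.
rewrite lerD2l exprMn -mulrA ler_wpM2l ?sqr_ge0//.
apply: (@le_trans _ _ (1 * psum J 1 (fun k j => psi k j (tnth x k) ^+ 2))).
  by rewrite ler_wpM2r// psum_ge0// => *; exact: sqr_ge0.
(* There are 1 + pJ features; the constant feature 1 is covered by M^2 because M >= 1. *)
rewrite mul1r -psum_cst; apply: ler_psum => [|k j _].
  by rewrite expr_ge1// (le_trans ler01).
have h : `|psi k j (tnth x k)| <= M by apply: psiM; exact: x01.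
by rewrite -[leLHS]real_normK ?num_real// lerXn2r// nnegrE (le_trans ler01).
Qed.

Let step_bnd u x : R := prisk J u + gam ^+ 2 * ((1 + (p * J)%:R) * M ^+ 2)
  - gam * c1 * (evalp psi J u x - q x) ^+ 2
  + gam * (c2 ^+ 2 / c1) * (evalp psi J ptheta x - q x) ^+ 2.

Lemma norm_le_itv (a b : R) : `|a| <= b -> - b <= a <= b.
Proof. by rewrite ler_norml. Qed.

Lemma integral_step_le u x : supported J u -> l1n J u <= Rad -> in_cube x ->
  (\int[leb1]_y (prisk J (step u x y) * (pX x * pYX x y))%:E <=
   (pX x * step_bnd u x)%:E)%E.
Proof.
move=> su uR x01.
have M0 : 0 <= M by rewrite (le_trans ler01).
have pX0 : 0 <= pX x by have /andP[h _] := pXC x01; rewrite (le_trans (ltW C10)).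
set v := evalp psi J u x.
(* The l1 constraint on u confines the prediction to [-B, B], where the density bounds are
   available. *)
have vB : - (M * Rad) <= v <= M * Rad.
  by apply: norm_le_itv; rewrite (le_trans (norm_evalp_le M1 psiM _ _ x01))// ler_wpM2l.
have qB : - (M * Rad) <= q x <= M * Rad.
  by apply: norm_le_itv; exact: (norm_q_le M1 psiM theta_l1 model x01).
have mf : measurable_fun setT (pYX x) := measurableT_comp mpYX (pair1_measurable x).
have f0 y : 0 <= pYX x y by exact: pYX0.
have [Fv [IF /andP[F0 F1] h1 h2]] := cdf_quantile_bounds mf f0 (pYX1 x01) tau01
  (ltW c10) (fun y => @pYXc x y x01) vB qB.
rewrite -/(q x) in h1 h2.
(* v and v + 1 represent the two outcomes of the indicator, so that r true and r false are the two
   possible risks after the step. *)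
pose r b := prisk J (step u x (if b then v else v + 1)).
have stepE y : step u x y = step u x (if y <= v then v else v + 1).
  rewrite /step /pfgd_step -/J -/v; case: (leP y v) => yv; first by rewrite lexx.
  by rewrite gerDl ler10.
have rE y : prisk J (step u x y) = if y <= v then r true else r false.
  by rewrite stepE /r; case: (y <= v).
have r0 b : 0 <= r b by exact: risk_ge0.
have -> : (\int[leb1]_y (prisk J (step u x y) * (pX x * pYX x y))%:E =
    (pX x * (r true * Fv + r false * (1 - Fv)))%:E)%E.
  rewrite EFinM -(integral_step_density mf f0 (pYX1 x01) IF)// -ge0_integralZl//; last 2 first.
  - apply/measurable_EFinP; apply: (measurable_funM _ mf).
    by apply: measurable_fun_ifT => //; exact: measurable_fun_ler.
  - by move=> y _; rewrite lee_fin mulr_ge0//; case: ifP.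
  by apply: eq_integral => y _; rewrite rE -EFinM mulrCA.
rewrite lee_fin ler_wpM2l//.
have e1 : r true <= prisk J u + 2 * gam * (tau - 1) * (v - evalp psi J ptheta x) +
    gam ^+ 2 * ((1 + (p * J)%:R) * M ^+ 2).
  by apply: risk_step_le => //; rewrite -/v lexx.
have e0 : r false <= prisk J u + 2 * gam * (tau - 0) * (v - evalp psi J ptheta x) +
    gam ^+ 2 * ((1 + (p * J)%:R) * M ^+ 2).
  by apply: risk_step_le => //; rewrite -/v gerDl ler10.
apply: (mixture_le _ gam0 e1 e0); first by rewrite F0.
exact: quantile_gap_le.
Qed.

Variables (d : measure_display) (T : measurableType d) (P : probability T R).
Variables (X : T -> p.-tuple R) (Y : T -> R).
Hypothesis mX : measurable_fun setT X.
Hypothesis mY : measurable_fun setT Y.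
Hypothesis lawE : forall B : set (p.-tuple R * R), measurable B ->
  P ((fun w => (X w, Y w)) @^-1` B) =
  cube_int (fun x => (pX x)%:E *
    \int[leb1]_y ((\1_B (x, y))%:E * (pYX x y)%:E))%E.

Let pX0 x : in_cube x -> 0 <= pX x.
Proof. by move=> x01; have /andP[h _] := pXC x01; rewrite (le_trans (ltW C10)). Qed.

(** By [riskE] the risk is a polynomial in finitely many coordinates plus a constant, so no
    measurability of a parameter-dependent integral is involved. *)
Lemma measurable_risk d' (T' : measurableType d') (u : T' -> param R p) n :
  mparam u -> (forall a, supported n (u a)) -> (forall a, l1n n (u a) <= Rad) ->
  measurable_fun setT (fun a => prisk n (u a)).
Proof.
move=> [mu1 mu2] su uR.
rewrite (_ : (fun _ => _) = fun a => dist2 n (u a) ptheta + ptail n); last first.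
  by apply/funext => a; exact: riskE'.
apply: measurable_funD => //.
apply: (measurable_psum n (a := fun a => ((u a).1 - alpha) ^+ 2)
  (b := fun a k j => ((u a).2 k j - theta k j) ^+ 2)) => [|k j];
  by apply: measurable_funX; exact: measurable_funB.
Qed.

(** The law of (X, Y) has total mass 1, and the conditional density integrates to 1 in y; integrate
    the constant 1. *)
Let Rintegral_pX : \int[mu]_(x in D) pX x = 1.
Proof.
have := integral_law mpX pX0 mpYX pYX0 mX mY lawE (phi := cst 1) (measurable_cst _)
  (fun _ => ler01).
have -> : (\int[P]_w (cst 1 (X w, Y w))%:E = 1)%E.
  transitivity (\int[P]_w cst 1%E w)%E => //; rewrite integral_cst// mul1e.
  exact: probability_setT.
move=> e.
rewrite /Rintegral [X in fine X](_ : _ = 1%E)// [RHS]e; apply: eq_integral => x /set_mem x01.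
transitivity ((pX x)%:E * \int[leb1]_y (pYX x y)%:E)%E; first by rewrite pYX1// mule1.
have mf : measurable_fun setT (pYX x) := measurableT_comp mpYX (pair1_measurable x).
rewrite -ge0_integralZl//.
- by apply: eq_integral => y _; rewrite mul1r EFinM.
- exact/measurable_EFinP.
- by move=> y _; rewrite lee_fin pYX0.
- by rewrite lee_fin pX0.
Qed.

Lemma expected_risk_step u : supported J u -> l1n J u <= Rad ->
  (\int[P]_w (prisk J (step u (X w) (Y w)))%:E <=
   ((1 - gam * c1 * C1) * prisk J u + gam * (c2 ^+ 2 / c1) * C2 * ptail J
    + gam ^+ 2 * ((1 + (p * J)%:R) * M ^+ 2))%:E)%E.
Proof.
move=> su uR.
pose phi (z : p.-tuple R * R) := prisk J (step u z.1 z.2).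
have mphi : measurable_fun setT phi.
  apply: measurable_risk.
  - by apply: mparam_pfgd_step => //; split=> [|k j]; exact: measurable_cst.
  - by move=> z; exact: supported_step.
  - by move=> z; exact: l1n_step.
have phi0 z : 0 <= phi z by exact: risk_ge0.
rewrite (integral_law mpX pX0 mpYX pYX0 mX mY lawE mphi phi0).
have mD := @measurable_cube R p.
have [x0 x001] : exists x, @in_cube R p x.
  by exists [tuple of nseq p 0] => k; rewrite tnth_nseq lexx ler01.
have C12 : C1 <= C2 by have /andP[h1 h2] := pXC x001; exact: le_trans h2.
have c1g := ltW c10.
have C20 : 0 <= C2 by rewrite (le_trans _ C12)// ltW.
pose K := prisk J u + gam ^+ 2 * ((1 + (p * J)%:R) * M ^+ 2).
pose f2 x := (evalp psi J u x - q x) ^+ 2.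
pose f3 x := (evalp psi J ptheta x - q x) ^+ 2.
have i1 : mu.-integrable D (EFin \o pX).
  apply: (@integrable_cube _ _ _ C2); first exact: measurable_funTS.
  by move=> x x01; rewrite ger0_norm ?pX0//; have /andP[] := pXC x01.
have i2 : mu.-integrable D (EFin \o f2).
  exact: (risk_integrable M1 Rad0 mpsi psiM theta_l1 model uR).
have i3 : mu.-integrable D (EFin \o f3).
  exact: (risk_integrable M1 Rad0 mpsi psiM theta_l1 model (l1n_theta_le theta_l1 J)).
have iZ (c : R) f : mu.-integrable D (EFin \o f) ->
    mu.-integrable D (EFin \o (fun x => c * f x)).
  by move=> h; exact: (integrableZl mD c h).
have iD (f g : p.-tuple R -> R) : mu.-integrable D (EFin \o f) ->
    mu.-integrable D (EFin \o g) -> mu.-integrable D (EFin \o (fun x => f x + g x)).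
  by move=> h1 h2; exact: (integrableD mD h1 h2).
(* An upper bound whose integral is explicit: [pX] integrates to 1, f2 to the risk of u, and f3 to
   the tail. *)
pose bnd x := K * pX x + ((- (gam * c1 * C1)) * f2 x + (gam * (c2 ^+ 2 / c1) * C2) * f3 x).
have ib : mu.-integrable D (EFin \o bnd).
  by apply: (iD _ _ (iZ _ _ i1)); apply: (iD _ _ (iZ _ _ i2) (iZ _ _ i3)).
apply: (@le_trans _ _ (\int[mu]_(x in D) (bnd x)%:E)%E).
  apply: ge0_le_integral => //.
  - move=> x x01; apply: integral_ge0 => y _.
    by rewrite lee_fin !mulr_ge0// ?pX0// pYX0.
  - exact: (measurable_integral_law mpX pX0 mpYX pYX0 mphi phi0).
  - exact: (measurable_int mu ib).
  - move=> x x01; apply: le_trans (integral_step_le su uR x01) _; rewrite lee_fin.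
    rewrite /step_bnd -/K -/(f2 x) -/(f3 x) /bnd.
    have [/andP[h1 h2] f20 f30] : [/\ C1 <= pX x <= C2, 0 <= f2 x & 0 <= f3 x].
      by split; [exact: pXC|exact: sqr_ge0|exact: sqr_ge0].
    have e1 : gam * c1 * f2 x * C1 <= gam * c1 * f2 x * pX x.
      by rewrite ler_wpM2l//; do 2 apply: mulr_ge0 => //.
    have e2 : gam * (c2 ^+ 2 / c1) * f3 x * pX x <= gam * (c2 ^+ 2 / c1) * f3 x * C2.
      by rewrite ler_wpM2l//; do 2 apply: mulr_ge0 => //; rewrite divr_ge0 ?sqr_ge0.
    exact: weighted_step_le.
have -> : (\int[mu]_(x in D) (bnd x)%:E = (\int[mu]_(x in D) bnd x)%:E)%E.
  by rewrite /Rintegral fineK//; exact: integrable_fin_num.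
rewrite lee_fin /bnd RintegralD//; [|exact: iZ|by apply: iD; exact: iZ].
rewrite RintegralD//; [|exact: iZ..].
rewrite !RintegralZl// Rintegral_pX /f2 -/(prisk J u).
have -> : \int[mu]_(x in D) f3 x = ptail J.
  by apply: eq_Rintegral => x _; rewrite evalp_trunc.
rewrite /K mulr1 le_eqVlt; apply/orP; left; apply/eqP; ring.
Qed.

End step.
End one_step.

(** * Rate of the recursion *)

Section rate.
Variable R : realType.

(** The quotient of the two powers is (1 + 1/t)^b, which is at most 1 + 1/t because b <= 1. *)
Lemma powRN_pred_le (b : R) (t : nat) : 0 <= b <= 1 -> (0 < t)%N ->
  t%:R `^ (- b) <= t.+1%:R / t%:R * t.+1%:R `^ (- b).
Proof.
move=> /andP[b0 b1] t0.
have t0' : 0 < t%:R :> R by rewrite ltr0n.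
have tt : t%:R = t.+1%:R * (t.+1%:R / t%:R)^-1 :> R.
  by rewrite invf_div mulrCA divff ?mulr1 ?pnatr_eq0.
rewrite {1}tt powRM// ?invr_ge0 ?divr_ge0// mulrC ler_wpM2r ?powR_ge0//.
rewrite -powR_inv1 ?divr_ge0// -powRrM mulN1r opprK.
rewrite -[leRHS]powRr1 ?divr_ge0//; apply: ler_powR => //.
by rewrite ler_pdivlMr// mul1r ler_nat.
Qed.

Lemma robbins_monro_rate (e : nat -> R) (a b B K : R) :
  2 <= a -> 0 <= b <= 1 -> 0 <= K -> (forall t, e t <= B) ->
  (forall t, a <= t.+1%:R ->
    e t.+1 <= (1 - a / t.+1%:R) * e t + K / t.+1%:R * t.+1%:R `^ (- b)) ->
  exists C, exists N : nat, forall t, (N <= t)%N -> e t <= C * t%:R `^ (- b).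
Proof.
move=> a2 b01 K0 eB erec.
pose N := (Num.truncn a).+1.
have aN : a < N%:R by exact: truncnS_gt.
have pw0 t : (0 < t)%N -> 0 < t%:R `^ (- b) :> R by move=> t0; rewrite powR_gt0 ?ltr0n.
(* The second summand settles t = N through the uniform bound B; the first gives K <= C for the
   induction. N exceeds a, so the contraction factor stays nonnegative. *)
pose C := K + `|B| / N%:R `^ (- b).
have C0 : 0 <= C by rewrite addr_ge0// divr_ge0// powR_ge0.
have KC : K <= C by rewrite lerDl divr_ge0// powR_ge0.
exists C, N => t; elim: t => [//|t ih].
rewrite leq_eqVlt => /predU1P[<-|Nt].
  rewrite (le_trans (eB _))// (le_trans (ler_norm _))//.
  rewrite /C mulrDl divfK ?lt0r_neq0 ?pw0//.
  by rewrite lerDr mulr_ge0// powR_ge0.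
have {}ih := ih Nt.
have t0 : (0 < t)%N by move: Nt; rewrite ltnS; exact: leq_trans.
have t0' : 0 < t%:R :> R by rewrite ltr0n.
have at1 : a <= t.+1%:R by rewrite (le_trans (ltW aN))// ler_nat ltnW.
have coef : 0 <= 1 - a / t.+1%:R by rewrite subr_ge0 ler_pdivrMr ?ltr0n// mul1r.
apply: le_trans (erec t at1) _.
apply: (@le_trans _ _ ((1 - a / t.+1%:R) * (C * (t.+1%:R / t%:R * t.+1%:R `^ (- b)))
    + K / t.+1%:R * t.+1%:R `^ (- b))).
  by rewrite lerD2r ler_wpM2l// (le_trans ih)// ler_wpM2l// powRN_pred_le.
have := ltW (pw0 t.+1 isT); move: (t.+1%:R `^ (- b)) => y y0.
rewrite [leLHS](_ : _ =
  ((1 - a / t.+1%:R) * (C * (t.+1%:R / t%:R)) + K / t.+1%:R) * y); last by ring.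
rewrite ler_wpM2r//.
have -> : (1 - a / t.+1%:R) * (C * (t.+1%:R / t%:R)) = C * (t.+1%:R - a) / t%:R.
  have z0 : t.+1%:R != 0 :> R by rewrite pnatr_eq0.
  move: (t.+1%:R : R) (t%:R : R) z0 (lt0r_neq0 t0') => z w z0 w0.
  by field; rewrite z0 w0.
(* The two fractions add up to C (t + 2 - a) / t, which is at most C because a >= 2. *)
apply: (@le_trans _ _ (C * (t.+1%:R - a) / t%:R + C / t%:R)).
  rewrite lerD2l ler_pM ?invr_ge0// lef_pV2 ?posrE ?ltr0n// ler_nat.
  exact: leqnSn.
rewrite -mulrDl ler_pdivrMr// -[X in _ + X <= _]mulr1 -mulrDr ler_wpM2l//.
by rewrite -natr1; move: t%:R => z; lra.
Qed.

Variable s : R.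
Hypothesis s0 : 0 < s.

Local Notation e := (1 / (2 * s + 1)).
Local Notation b := (2 * s / (2 * s + 1)).

Let den_gt0 : 0 < 2 * s + 1.
Proof. by rewrite ltr_wpDl// ltW// mulr_gt0. Qed.

Let e_ge0 : 0 <= e.
Proof. by rewrite divr_ge0// ltW. Qed.

Lemma Jt_natE t : (Jt s t)%:R = (Num.ceil (t%:R `^ e))%:~R :> R.
Proof.
have c0 : 0 <= Num.ceil (t%:R `^ e) :> int.
  by rewrite ceil_ge0 (lt_le_trans _ (powR_ge0 _ _))// ltrN10.
by rewrite /Jt natr_absz ger0_norm.
Qed.

Lemma Jt_ge t : t%:R `^ e <= (Jt s t)%:R.
Proof. by rewrite Jt_natE ceil_ge. Qed.

Lemma Jt_le t : (0 < t)%N -> (Jt s t)%:R <= 2 * t%:R `^ e.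
Proof.
move=> t0; rewrite Jt_natE.
have := ceilB1_lt (t%:R `^ e); rewrite intrB.
have h : 1 <= t%:R `^ e :> R.
  by rewrite -[leLHS](powRr0 t%:R); apply: ler_powR => //; rewrite ler1n.
by move: (t%:R `^ e) ((Num.ceil _)%:~R : R) h => x y h1 h2; lra.
Qed.

Lemma Jt_homo m n : (m <= n)%N -> (Jt s m <= Jt s n)%N.
Proof.
move=> mn; rewrite -(ler_nat R) !Jt_natE ler_int; apply: le_ceil.
by apply: ge0_ler_powR; rewrite ?nnegrE// ler_nat.
Qed.

(** Write e = 1/(2s+1) and b = 2s/(2s+1). Truncation: J >= t^e gives tl <= W t^(-b), as 2s e = b.
    Gradient norm: 1 + pJ is of order t^e = t * t^(-b), as e = 1 - b. Both terms are then of order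
    t^(-1) t^(-b). *)
Lemma step_error_le (A c W M tl : R) (p t : nat) : (0 < t)%N -> 0 <= A -> 0 <= c ->
  tl * (Jt s t)%:R `^ (2 * s) <= W -> 0 <= tl ->
  A / t%:R * c * tl + (A / t%:R) ^+ 2 * ((1 + (p * Jt s t)%:R) * M ^+ 2) <=
  (A * c * W + A ^+ 2 * ((1 + 2 * p%:R) * M ^+ 2)) / t%:R * t%:R `^ (- b).
Proof.
move=> t0 A0 c0 tW tl0; have t0' : 0 < t%:R :> R by rewrite ltr0n.
have pb : 0 < t%:R `^ b :> R by rewrite powR_gt0.
have tlW : tl <= W * t%:R `^ (- b).
  rewrite powRN ler_pdivlMr// (le_trans _ tW)// ler_wpM2l//.
  rewrite (_ : b = e * (2 * s)); last by rewrite mul1r mulrC.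
  rewrite [leLHS]powRrM; apply: ge0_ler_powR; rewrite ?nnegrE ?powR_ge0//.
    by rewrite mulr_ge0// ltW.
  exact: Jt_ge.
have pe : 1 <= t%:R `^ e :> R.
  by rewrite -[leLHS](powRr0 t%:R); apply: ler_powR => //; rewrite ler1n.
have pJ : 1 + (p * Jt s t)%:R <= (1 + 2 * p%:R) * t%:R `^ e.
  rewrite natrM mulrDl mul1r lerD// [2 * _]mulrC -mulrA ler_wpM2l//.
  exact: Jt_le.
have peb : t%:R `^ e = t%:R * t%:R `^ (- b) :> R.
  rewrite -{2}(powRr1 (ltW t0')) -powRD; last by rewrite (gt_eqF t0') implybT.
  congr (_ `^ _); field; exact: lt0r_neq0.
rewrite [leRHS](_ : _ = A * c * W / t%:R * t%:R `^ (- b) +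
  A ^+ 2 * ((1 + 2 * p%:R) * M ^+ 2) / t%:R * t%:R `^ (- b)); last by ring.
rewrite lerD//.
  rewrite [leRHS](_ : _ = A / t%:R * c * (W * t%:R `^ (- b))); last by ring.
  by rewrite ler_wpM2l// !mulr_ge0// invr_ge0 ltW.
apply: (@le_trans _ _ ((A / t%:R) ^+ 2 * (((1 + 2 * p%:R) * t%:R `^ e) * M ^+ 2))).
  by rewrite ler_wpM2l ?sqr_ge0// ler_wpM2r ?sqr_ge0.
rewrite peb le_eqVlt; apply/orP; left; apply/eqP; field; exact: lt0r_neq0.
Qed.

End rate.

(** * Recursion for the expected risk *)

Lemma l1n_supported (R : realType) (p J n : nat) (u : param R p) :
  supported J u -> (J <= n)%N -> l1n n u = l1n J u.
Proof.
move=> su Jn; rewrite /l1n; congr (_ + _); apply: eq_bigr => k _.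
rewrite -!(big_mkord xpredT (fun j => `|u.2 k j|)).
rewrite (big_cat_nat (leq0n J) Jn)/= [X in _ + X]big_nat_cond [X in _ + X]big1 ?addr0//.
by move=> j /andP[/andP[Jj _] _]; rewrite su// normr0.
Qed.

Lemma mparam_comp (R : realType) (p : nat) (d1 d2 : measure_display)
    (T1 : measurableType d1) (T2 : measurableType d2) (u : T2 -> param R p) (g : T1 -> T2) :
  mparam u -> measurable_fun setT g -> mparam (u \o g).
Proof.
move=> [mu1 mu2] mg; split=> [|k j]; first exact: (measurableT_comp mu1 mg).
exact: (measurableT_comp (mu2 k j) mg).
Qed.

(** * The past as a sigma-algebra, independent of the next observation *)

Section history.
Variables (R : realType) (d d2 : measure_display) (T : measurableType d).
Variables (T2 : measurableType d2) (P : probability T R) (Z : nat -> T -> T2).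
Hypothesis mZ : forall i, measurable_fun setT (Z i).
Hypothesis indep : forall S : seq nat, uniq S -> all (fun i => 0 < i)%N S ->
  forall B : nat -> set T2, (forall i, measurable (B i)) ->
  P (\bigcap_(i in [set` S]) (Z i @^-1` B i)) = (\prod_(i <- S) P (Z i @^-1` B i))%E.
Variable t : nat.

(* A pi-system generating the sigma-algebra of the first [t] observations. *)
Definition history : set (set T) :=
  [set A | exists B : nat -> set T2, (forall i, measurable (B i)) /\
     A = \bigcap_(i in [set` iota 1 t]) (Z i @^-1` B i)].

Lemma history_setI : setI_closed history.
Proof.
move=> _ _ [B [mB ->]] [B' [mB' ->]]; exists (fun i => B i `&` B' i); split.
  by move=> i; exact: measurableI.
by rewrite -bigcapI; apply: eq_bigcapr => i _; rewrite preimage_setI.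
Qed.

Lemma history_setT : history setT.
Proof.
exists (fun=> setT); split=> //.
by apply/esym/seteqP; split=> // w _ i _.
Qed.

Lemma history_measurable : history `<=` measurable.
Proof.
move=> _ [B [mB ->]]; apply: fin_bigcap_measurable.
  exact: finite_seq.
by move=> i _; rewrite -[X in measurable X]setTI; exact: mZ.
Qed.

Lemma history_indep A B : history A -> measurable B ->
  P (A `&` Z t.+1 @^-1` B) = (P A * P (Z t.+1 @^-1` B))%E.
Proof.
move=> [C [mC ->]] mB.
have tN : t.+1 \notin iota 1 t by rewrite mem_iota add1n ltnn andbF.
have pos : all (fun i => 0 < i)%N (iota 1 t).
  by apply/allP => i; rewrite mem_iota => /andP[].
pose E i := if i == t.+1 then B else C i.
have mE i : measurable (E i) by rewrite /E; case: ifP.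
have := @indep (t.+1 :: iota 1 t) _ _ E mE.
rewrite /= tN iota_uniq pos => /(_ isT isT).
rewrite big_cons {2}/E eqxx.
have EC i : i \in iota 1 t -> E i = C i.
  by rewrite /E => it; case: eqP => // it1; rewrite it1 (negbTE tN) in it.
rewrite big_seq (eq_bigr (fun i => P (Z i @^-1` C i))); last by move=> i /EC ->.
(* A second use of independence, on 1, ..., t alone, folds the product back into the probability of
   the past event. *)
rewrite -big_seq -indep// ?iota_uniq// muleC => <-.
congr (P _); apply/seteqP; split=> w /=.
  move=> [wC wB] i /=; rewrite inE => /predU1P[->|it]; first by rewrite /E eqxx.
  by rewrite /= EC//; exact: wC.
move=> wE; split=> [i /= it|]; last first.
  by have := wE t.+1; rewrite /= mem_head /E eqxx; exact.
by have := wE i; rewrite /= inE it orbT EC//; exact.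
Qed.

Lemma measurable_history i : (0 < i <= t)%N ->
  measurable_fun setT (Z i : g_sigma_algebraType history -> T2).
Proof.
move=> it _ B mB; rewrite setTI; apply: sub_sigma_algebra.
exists (fun j => if j == i then B else setT); split; first by move=> j; case: ifP.
apply/seteqP; split=> w /=.
  by move=> wB j _ /=; case: eqP => // ->.
by move=> /(_ i); rewrite /= mem_iota add1n ltnS it eqxx; exact.
Qed.

End history.

Lemma integral_prob_cst (R : realType) (d : measure_display) (T : measurableType d)
    (P : probability T R) (r : R) : (\int[P]_w r%:E = r%:E)%E.
Proof.
transitivity (r%:E * P setT)%E; first exact: integral_cst.
by rewrite probability_setT mule1.
Qed.

(** * From the one-step bound to the rate *)

Section recursion.
Variables (R : realType) (p : nat) (tau s A Rad M C1 C2 c1 c2 : R).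
Hypothesis tau01 : 0 < tau < 1.
Hypothesis A0 : 0 < A.
Hypothesis s0 : 0 < s.
Hypothesis Rad0 : 0 < Rad.
Hypothesis M1 : 1 <= M.
Hypothesis C10 : 0 < C1.
Hypothesis c10 : 0 < c1.
Variables (psi : 'I_p -> nat -> R -> R) (alpha : R) (theta : 'I_p -> nat -> R).
Local Notation leb1 := (@lebesgue_measure R).
Local Notation I01 := (`[0%R, 1%R]%classic : set (measurableTypeR R)).
Hypothesis mpsi : forall k j, measurable_fun setT (psi k j).
Hypothesis psiM : forall k j u, 0 <= u <= 1 -> `|psi k j u| <= M.
Hypothesis psi0 : forall k j, (\int[leb1]_(u in I01) (psi k j u)%:E = 0)%E.
Hypothesis psi_orth : forall k i j,
  (\int[leb1]_(u in I01) (psi k i u * psi k j u)%:E = ((i == j)%:R)%:E)%E.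
Hypothesis theta_l1 :
  ((`|alpha|)%:E + \sum_(k < p) \sum_(0 <= j <oo) (`|theta k j|)%:E <= Rad%:E)%E.
Variables (pX : p.-tuple R -> R) (pYX : p.-tuple R -> R -> R).
Hypothesis mpX : measurable_fun setT pX.
Hypothesis pXC : forall x, in_cube x -> C1 <= pX x <= C2.
Hypothesis mpYX : measurable_fun setT (fun z : p.-tuple R * R => pYX z.1 z.2).
Hypothesis pYX0 : forall x y, in_cube x -> 0 <= pYX x y.
Hypothesis pYX1 : forall x, in_cube x -> (\int[leb1]_y (pYX x y)%:E = 1)%E.
Hypothesis pYXc : forall x y, in_cube x -> - (M * Rad) <= y <= M * Rad ->
  c1 <= pYX x y <= c2.
Hypothesis model : forall x, in_cube x -> cond_quantile tau pYX x =
  alpha + \sum_(k < p) limn (fun n => \sum_(j < n) theta k j * psi k j (tnth x k)).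

Local Notation q := (cond_quantile tau pYX).
Local Notation ptheta := ((alpha, theta) : param R p).
Local Notation mu := (@cube_prob R p).
Local Notation D := (@cube R p).
Local Notation prisk := (risk psi q).
Local Notation ptail := (tail psi alpha theta q).
Variables (d : measure_display) (T : measurableType d) (P : probability T R).
Variables (X : nat -> T -> p.-tuple R) (Y : nat -> T -> R).
Hypothesis mX : forall t, measurable_fun setT (X t).
Hypothesis mY : forall t, measurable_fun setT (Y t).
Hypothesis lawE : forall t, (0 < t)%N -> forall B : set (p.-tuple R * R), measurable B ->
  P ((fun w => (X t w, Y t w)) @^-1` B) =
  cube_int (fun x => (pX x)%:E *
    \int[leb1]_y ((\1_B (x, y))%:E * (pYX x y)%:E))%E.
Hypothesis indep : forall S : seq nat, uniq S -> all (fun i => 0 < i)%N S ->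
  forall B : nat -> set (p.-tuple R * R), (forall i, measurable (B i)) ->
  P (\bigcap_(i in [set` S]) ((fun w => (X i w, Y i w)) @^-1` B i)) =
  (\prod_(i <- S) P ((fun w => (X i w, Y i w)) @^-1` B i))%E.

Definition iterate (t : nat) (w : T) : param R p :=
  pfgd_theta tau s A Rad psi (fun i => X i w) (fun i => Y i w) t.

Definition expected_risk t : \bar R := (\int[P]_w (prisk (Jt s t) (iterate t w))%:E)%E.

Definition step_error t : R :=
  A / t%:R * (c2 ^+ 2 / c1 * C2) * ptail (Jt s t) +
  (A / t%:R) ^+ 2 * ((1 + (p * Jt s t)%:R) * M ^+ 2).

Lemma supported_iterate t w : supported (Jt s t) (iterate t w).
Proof. by case: t => [//|t]; exact: supported_step. Qed.

Lemma l1n_iterate t w : l1n (Jt s t) (iterate t w) <= Rad.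
Proof.
case: t => [|t]; last exact: l1n_step.
rewrite l1nE /psum/= normr0 add0r big1 ?ltW// => k _.
by rewrite big1// => j _; rewrite normr0.
Qed.

Let mrisk d' (T' : measurableType d') (u : T' -> param R p) n := @measurable_risk
  R p tau Rad M Rad0 M1 psi alpha theta mpsi psiM psi0 psi_orth theta_l1 pYX model d' T' u n.

Let mrk t : measurable_fun setT (fun w => prisk (Jt s t) (iterate t w)).
Proof.
apply: mrisk; [|exact: supported_iterate|exact: l1n_iterate].
exact: mparam_pfgd_theta.
Qed.

Let rk0 n u : 0 <= prisk n u.
Proof. exact: risk_ge0. Qed.

Lemma expected_risk_ge0 t : (0 <= expected_risk t)%E.
Proof. by apply: integral_ge0 => w _; rewrite lee_fin. Qed.

Lemma expected_risk_le t : (expected_risk t <= ((2 * (M * Rad)) ^+ 2)%:E)%E.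
Proof.
rewrite -(integral_prob_cst P); apply: ge0_le_integral => //.
- by move=> w _; rewrite lee_fin.
- exact/measurable_EFinP.
- move=> w _; rewrite lee_fin.
  exact: (risk_le M1 Rad0 mpsi psiM theta_l1 model (l1n_iterate t w)).
Qed.

Lemma expected_risk_fin t : expected_risk t \is a fin_num.
Proof.
by rewrite ge0_fin_numE ?expected_risk_ge0// (le_lt_trans (expected_risk_le t)) ?ltry.
Qed.

Let C20 : 0 <= C2.
Proof.
have [x0 x001] : exists x, @in_cube R p x.
  by exists [tuple of nseq p 0] => k; rewrite tnth_nseq lexx ler01.
by have /andP[h1 h2] := pXC x001; rewrite (le_trans _ (le_trans h1 h2))// ltW.
Qed.

Lemma step_error_ge0 t : 0 <= step_error t.
Proof.
have At : 0 <= A / t%:R by rewrite divr_ge0// ltW.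
apply: addr_ge0.
  apply: mulr_ge0; last exact: rk0.
  apply: mulr_ge0 => //; apply: mulr_ge0 => //.
  by rewrite divr_ge0 ?sqr_ge0// ltW.
by apply: mulr_ge0; rewrite ?sqr_ge0// mulr_ge0 ?sqr_ge0// addr_ge0.
Qed.

(** Independence replaces the new observation by a fresh copy; with w fixed, the one-step bound
    applies to a deterministic parameter and is then integrated over w. The condition on t keeps the
    contraction factor nonnegative, as linearity for nonnegative integrands requires. *)
Lemma expected_risk_rec t : A * (c1 * C1) <= t.+1%:R ->
  fine (expected_risk t.+1) <=
  (1 - A * (c1 * C1) / t.+1%:R) * fine (expected_risk t) + step_error t.+1.
Proof.
pose a := A * (c1 * C1); rewrite -/a => at1.
have coef : 0 <= 1 - a / t.+1%:R by rewrite subr_ge0 ler_pdivrMr// mul1r.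
pose J := Jt s t.+1.
have JJ : (Jt s t <= J)%N by exact: Jt_homo s0 _ _ (leqnSn t).
pose stp := pfgd_step tau s A Rad psi t.+1.
pose Z i w := (X i w, Y i w).
have mZ i : measurable_fun setT (Z i) by exact: measurable_fun_pair.
have Z1 d' (T' : measurableType d') (z : T' -> p.-tuple R * R) :
  measurable_fun setT z -> measurable_fun setT (fun a => (z a).1).
  by move=> mz; exact: (measurableT_comp measurable_fst mz).
have Z2 d' (T' : measurableType d') (z : T' -> p.-tuple R * R) :
  measurable_fun setT z -> measurable_fun setT (fun a => (z a).2).
  by move=> mz; exact: (measurableT_comp measurable_snd mz).
pose TG := g_sigma_algebraType (history Z t).
(* The past enters through [TG], that is, T with the sigma-algebra of the first t observations, for
   which the iterate is measurable. *)
pose Phi (z : TG * (p.-tuple R * R)) : \bar R := (prisk J (stp (iterate t z.1) z.2.1 z.2.2))%:E.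
have mPhi : measurable_fun setT Phi.
  apply/measurable_EFinP; apply: mrisk.
  - apply: mparam_pfgd_step => //.
    + apply: (@mparam_comp R p _ _ _ TG (iterate t) fst); last exact: measurable_fst.
      apply: (@mparam_pfgd_theta R p _ TG tau s A Rad psi X Y t) => // i it.
      * have h : measurable_fun [set: TG] (fun a => (Z i a).1).
          exact (Z1 _ TG (Z i) (@measurable_history _ _ _ _ Z t i it)).
        exact h.
      * have h : measurable_fun [set: TG] (fun a => (Z i a).2).
          exact (Z2 _ TG (Z i) (@measurable_history _ _ _ _ Z t i it)).
        exact h.
    + by apply: Z1; exact: measurable_snd.
    + by apply: Z2; exact: measurable_snd.
  - by move=> z; exact: supported_step.
  - by move=> z; exact: l1n_step.
have Phi0 z : (0 <= Phi z)%E by rewrite lee_fin.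
have EE : (expected_risk t.+1 = \int[P]_w \int[P]_w' Phi (w, Z t.+1 w'))%E.
  transitivity (\int[P]_w Phi (w, Z t.+1 w))%E; first by [].
  have hI A' B := @history_indep _ _ _ _ _ P Z indep t A' B.
  exact (ge0_integral_indep (mZ t.+1) (@history_setI _ _ _ _ Z t) (history_setT Z t)
    (history_measurable mZ (t := t)) hI mPhi Phi0).
pose r w := (1 - a / t.+1%:R) * prisk (Jt s t) (iterate t w) + step_error t.+1.
have Kt0 := step_error_ge0 t.+1.
have step_le w : (\int[P]_w' Phi (w, Z t.+1 w') <= (r w)%:E)%E.
  have su : supported J (iterate t w).
    by move=> k j Jj; apply: (supported_iterate (t := t)); exact: leq_trans Jj.
  have su0 := @supported_iterate t w.
  have uR : l1n J (iterate t w) <= Rad by rewrite (l1n_supported su0 JJ) l1n_iterate.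
  have := @expected_risk_step R p tau s A Rad M C1 C2 c1 c2 tau01 (ltW A0) Rad0 M1 C10 c10
    psi alpha theta mpsi psiM psi0 psi_orth theta_l1 pX pYX mpX pXC mpYX pYX0 pYX1 pYXc
    model t.+1 d T P (X t.+1) (Y t.+1) (mX _) (mY _) (@lawE t.+1 isT) _ su uR.
  move=> h; apply: (le_trans h); rewrite lee_fin /r.
  (* Zero padding from dimension Jt s t to J leaves the risk unchanged, which closes the recursion
     although the dimension grows. *)
  rewrite -(risk_widen psi q su0 JJ) -/J /step_error -/J /a.
  rewrite le_eqVlt; apply/orP; left; apply/eqP.
  by rewrite -addrA; congr (_ + _); [congr (_ * _)|congr (_ + _)]; ring.
rewrite -lee_fin fineK ?expected_risk_fin// EE EFinD EFinM fineK ?expected_risk_fin//.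
apply: (@le_trans _ _ (\int[P]_w (r w)%:E)%E).
  apply: ge0_le_integral => //.
  - by move=> w _; apply: integral_ge0.
  - apply: (@measurable_fun_fubini_tonelli_F _ _ _ _ _ P
      (* The outer integral is over T with its full sigma-algebra, so joint measurability is
         established again on T x T. *)
      (fun z : T * T => (prisk J (stp (iterate t z.1) (X t.+1 z.2) (Y t.+1 z.2)))%:E)).
      apply/measurable_EFinP; apply: mrisk.
      + apply: mparam_pfgd_step => //.
        * apply: (@mparam_comp R p _ _ _ T (iterate t) fst); last exact: measurable_fst.
          exact: mparam_pfgd_theta.
        * exact: (measurableT_comp (mX _) measurable_snd).
        * exact: (measurableT_comp (mY _) measurable_snd).
      + by move=> z; exact: supported_step.
      + by move=> z; exact: l1n_step.
    by move=> z; rewrite lee_fin.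
  - apply/measurable_EFinP; apply: measurable_funD => //; exact: measurable_funM.
rewrite /r; under eq_integral do rewrite EFinD EFinM.
have mE : measurable_fun setT (fun w => (prisk (Jt s t) (iterate t w))%:E).
  exact/measurable_EFinP.
have mcE : measurable_fun setT
    (fun w => (1 - a / t.+1%:R)%:E * (prisk (Jt s t) (iterate t w))%:E)%E.
  exact: emeasurable_funM.
rewrite (ge0_integralD _ measurableT _ mcE)//; last first.
  by move=> w _; rewrite mule_ge0 ?lee_fin.
rewrite integral_prob_cst (ge0_integralZl _ measurableT mE)// => w _.
by rewrite lee_fin.
Qed.

Lemma expected_risk_rate Q : 2 / (c1 * C1) <= A ->
  (forall k, (\sum_(0 <= j <oo) ((j.+1%:R `^ (2 * s)) * theta k j ^+ 2)%:E
              < (Q ^+ 2)%:E)%E) ->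
  exists C, exists N : nat, forall t, (N <= t)%N ->
    (expected_risk t <= (C * t%:R `^ (- (2 * s) / (2 * s + 1)))%:E)%E.
Proof.
move=> AA0 hQ.
have a2 : 2 <= A * (c1 * C1) by rewrite -ler_pdivrMr// mulr_gt0.
have den : 0 < 2 * s + 1 by rewrite ltr_wpDl// ltW// mulr_gt0.
have b01 : 0 <= 2 * s / (2 * s + 1) <= 1.
  apply/andP; split; first by rewrite divr_ge0// ltW// mulr_gt0.
  by rewrite ler_pdivrMr// mul1r lerDl.
pose c := c2 ^+ 2 / c1 * C2.
have c0 : 0 <= c by rewrite mulr_ge0// divr_ge0 ?sqr_ge0// ltW.
pose K := A * c * (p%:R * Q ^+ 2) + A ^+ 2 * ((1 + 2 * p%:R) * M ^+ 2).
have K0 : 0 <= K.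
  apply: addr_ge0; apply: mulr_ge0; rewrite ?sqr_ge0//.
  - by rewrite mulr_ge0// ltW.
  - by rewrite mulr_ge0// sqr_ge0.
  - by rewrite mulr_ge0 ?sqr_ge0// addr_ge0// mulr_ge0.
have eB t : fine (expected_risk t) <= (2 * (M * Rad)) ^+ 2.
  by rewrite -lee_fin fineK ?expected_risk_fin// expected_risk_le.
have erec t : A * (c1 * C1) <= t.+1%:R -> fine (expected_risk t.+1) <=
    (1 - A * (c1 * C1) / t.+1%:R) * fine (expected_risk t) +
    K / t.+1%:R * t.+1%:R `^ (- (2 * s / (2 * s + 1))).
  move=> at1; apply: le_trans (expected_risk_rec at1) _; rewrite lerD2l.
  apply: step_error_le => //; first exact: ltW.
  - exact: (tail_le M1 Rad0 mpsi psiM psi0 psi_orth theta_l1 model _ (ltW s0) hQ).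
  - exact: rk0.
have [C [N h]] := robbins_monro_rate a2 b01 K0 eB erec.
exists C, N => t Nt; rewrite -[leLHS]fineK ?expected_risk_fin// lee_fin mulNr.
exact: h.
Qed.

End recursion.

Theorem theorem1 (R : realType) (p : nat) (tau s Q Rad M C1 C2 c1 c2 : R) :
  0 < tau < 1 -> 1 / 2 < s -> 0 < Q -> 0 < Rad -> 1 <= M ->
  0 < C1 -> 0 < c1 ->
  exists A0 : R, 0 < A0 /\
  forall A : R, A0 <= A ->
  forall (psi : 'I_p -> nat -> R -> R) (alpha : R) (theta : 'I_p -> nat -> R)
    (d : measure_display) (T : measurableType d) (P : probability T R)
    (X : nat -> T -> p.-tuple R) (Y : nat -> T -> R)
    (pX : p.-tuple R -> R) (pYX : p.-tuple R -> R -> R),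
  (* bases: psi k j = psi_{k,j+1}, a bounded centered orthonormal basis of the
     centered subspace of L2[0,1] *)
  (forall k j, measurable_fun setT (psi k j)) ->
  (forall k j u, 0 <= u <= 1 -> `|psi k j u| <= M) ->
  (forall k j, (\int[@lebesgue_measure R]_(u in `[0%R, 1%R]) (psi k j u)%:E = 0)%E) ->
  (forall k i j, (\int[@lebesgue_measure R]_(u in `[0%R, 1%R]) (psi k i u * psi k j u)%:E
                   = ((i == j)%:R)%:E)%E) ->
  (forall k (g : R -> R), measurable_fun (`[0%R, 1%R] : set R) g ->
     (\int[@lebesgue_measure R]_(u in `[0%R, 1%R]) (g u ^+ 2)%:E < +oo)%E ->
     (\int[@lebesgue_measure R]_(u in `[0%R, 1%R]) (g u)%:E = 0)%E ->
     (fun n => \int[@lebesgue_measure R]_(u in `[0%R, 1%R])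
        ((g u - \sum_(j < n)
            fine (\int[@lebesgue_measure R]_(v in `[0%R, 1%R]) (g v * psi k j v)%:E)
            * psi k j u) ^+ 2)%:E)%E @ \oo --> 0%E) ->
  (* Sobolev-type smoothness: sum_j j^{2s} theta_{kj}^2 < Q^2 *)
  (forall k, (\sum_(0 <= j <oo) ((j.+1%:R `^ (2 * s)) * theta k j ^+ 2)%:E
              < (Q ^+ 2)%:E)%E) ->
  (* l1 bound ||theta*||_1 <= R *)
  ((`|alpha|)%:E + \sum_(k < p) \sum_(0 <= j <oo) (`|theta k j|)%:E <= Rad%:E)%E ->
  (* (A1) *)
  measurable_fun setT pX ->
  (forall x, in_cube x -> C1 <= pX x <= C2) ->
  (* (A2), with B = M * Rad *)
  measurable_fun setT (fun z : p.-tuple R * R => pYX z.1 z.2) ->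
  (forall x y, in_cube x -> 0 <= pYX x y) ->
  (forall x, in_cube x -> (\int[@lebesgue_measure R]_y (pYX x y)%:E = 1)%E) ->
  (forall x y, in_cube x -> - (M * Rad) <= y <= M * Rad -> c1 <= pYX x y <= c2) ->
  (* the observations (X_t, Y_t), t >= 1, are random variables ... *)
  (forall t, measurable_fun setT (X t)) ->
  (forall t, measurable_fun setT (Y t)) ->
  (* ... each distributed as (X, Y), with density pX(x) pYX(y|x) on [0,1]^p x R ... *)
  (forall t, (0 < t)%N -> forall B : set (p.-tuple R * R), measurable B ->
     P ((fun w => (X t w, Y t w)) @^-1` B) =
     cube_int (fun x => (pX x)%:E *
       \int[@lebesgue_measure R]_y ((\1_B (x, y))%:E * (pYX x y)%:E))%E) ->
  (* ... and mutually independent *)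
  (forall (S : seq nat), uniq S -> all (fun i => 0 < i)%N S ->
   forall B : nat -> set (p.-tuple R * R), (forall i, measurable (B i)) ->
     P (\bigcap_(i in [set` S]) ((fun w => (X i w, Y i w)) @^-1` B i)) =
     (\prod_(i <- S) P ((fun w => (X i w, Y i w)) @^-1` B i))%E) ->
  (* additive model for the conditional quantile *)
  (forall x, in_cube x ->
     cond_quantile tau pYX x =
     alpha + \sum_(k < p) limn (fun n => \sum_(j < n) theta k j * psi k j (tnth x k))) ->
  (* conclusion: E ||qhat_t - q_tau||_{L2}^2 = O(t^{-2s/(2s+1)}) *)
  exists C : R, exists N : nat, forall t : nat, (N <= t)%N ->
    (\int[P]_w cube_int (fun x =>
        ((pfgd_qhat tau s A Rad psi (fun i => X i w) (fun i => Y i w) t x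
          - cond_quantile tau pYX x) ^+ 2)%:E)
     <= (C * t%:R `^ (- (2 * s) / (2 * s + 1)))%:E)%E.
Proof.
move=> tau01 s12 Q0 Rad0 M1 C10 c10.
exists (2 / (c1 * C1)); split=> [|A AA0]; first by rewrite divr_gt0// mulr_gt0.
move=> psi alpha theta d T P X Y pX pYX mpsi psiM psi0 psi_orth _ hQ theta_l1 mpX pXC
  mpYX pYX0 pYX1 pYXc mX mY lawE indep model.
have A0 : 0 < A by apply: lt_le_trans AA0; rewrite divr_gt0// mulr_gt0.
have s0 : 0 < s by rewrite (lt_trans _ s12)// divr_gt0.
have [C [N h]] := expected_risk_rate tau01 A0 s0 Rad0 M1 C10 c10 mpsi psiM psi0
  psi_orth theta_l1 mpX pXC mpYX pYX0 pYX1 pYXc model mX mY lawE indep AA0 hQ.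
(* The iterate lies in the l1-ball, so its iterated integral is the finite real [risk] and the two
   expectations coincide. *)
exists C, N => t /h; apply: le_trans; rewrite le_eqVlt; apply/orP; left; apply/eqP.
apply: eq_integral => w _.
exact: (cube_int_risk M1 Rad0 mpsi psiM theta_l1 model (l1n_iterate _ _ _ _ _ _ _ _ _)).
Qed.
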